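(* Let $\rho\in\mathbb R$, let $\mathbf a=\{a_n\}_{n\ge1}$ be an admissible sequence of non-negative real numbers, and let $\kappa_{\mathbf a}(s,u)=\sum_{n\ge1}a_nn^{-s-\bar u}$ be the diagonal Dirichlet series kernel on $\mathbb H_\rho\times\mathbb H_\rho$ associated with $\mathbf a$, with reproducing kernel Hilbert space $\mathscr H_{\mathbf a}$; write $\kappa_{\mathbf a,u}=\kappa_{\mathbf a}(\cdot,u)$. For every real $\alpha>\rho$, let $T_\alpha$ be the linear operator in $\mathscr H_{\mathbf a}$ with domain $\mathcal D(T_\alpha)=\mathrm{span}\{\kappa_{\mathbf a,\alpha+ib}:b\in\mathbb R\}$ defined by $T_\alpha\kappa_{\mathbf a,\alpha+ib}=ib\,\kappa_{\mathbf a,\alpha+ib}$, $b\in\mathbb R$, extended linearly. Then (i) $T_\alpha$ is a $\mathscr T$-homogeneous operator in $\mathscr H_{\mathbf a}$; (ii) the domain $\mathcal D(T_\alpha^* )$ of the Hilbert space adjoint of $T_\alpha$ is $\{0\}$. Consequently $T_\alpha$ is not closable.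
   Context: $\mathbb H_\rho=\{\Re s>\rho\}$. The diagonal Dirichlet series kernel associated with $\mathbf a$ is $\kappa_{\mathbf a}(s,u)=\sum_n a_nn^{-s-\bar u}$, assumed convergent on $\mathbb H_\rho\times\mathbb H_\rho$ (it is positive semi-definite); $\mathscr H_{\mathbf a}$ is the Hilbert space of functions on $\mathbb H_\rho$ with $\kappa_{\mathbf a}(\cdot,t)\in\mathscr H_{\mathbf a}$ and $\langle f,\kappa_{\mathbf a}(\cdot,t)\rangle=f(t)$. A sequence $\mathbf a$ of real numbers is admissible if its support $\mathrm{supp}(\mathbf a)=\{n:a_n\ne0\}$ is an infinite subset of $\mathbb N$ closed under multiplication and there exist $p,q\in\mathrm{supp}(\mathbf a)\setminus\{1\}$ with $\gcd(p,q)=1$. A densely defined linear operator $T$ with domain $\mathcal D(T)$ in a complex Hilbert space $\mathcal H$ is $\mathscr T$-homogeneous if for every $c\in\mathbb R$ there is a unitary $U_c$ on $\mathcal H$ with $U_c\mathcal D(T)\subseteq\mathcal D(T)$ and $U_cTf=(T-icI)U_cf$ for all $f\in\mathcal D(T)$. *)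

(* Defs.v *)
From Stdlib Require Import Reals List Arith.
From Coquelicot Require Import Coquelicot.
Open Scope R_scope.

Definition Hrho (rho : R) : Type := {s : C | rho < Re s}.

Definition Fun (rho : R) : Type := Hrho rho -> C.

Definition fzero {rho : R} : Fun rho := fun _ => RtoC 0.
Definition fadd {rho : R} (f g : Fun rho) : Fun rho := fun s => Cplus (f s) (g s).
Definition fscal {rho : R} (c : C) (f : Fun rho) : Fun rho := fun s => Cmult c (f s).
Definition fsub {rho : R} (f g : Fun rho) : Fun rho := fun s => Cminus (f s) (g s).

(** n^{-s} = exp(-s log n) for n >= 1 and complex s. *)
Definition npow (n : nat) (s : C) : C :=
  let r := exp (- Re s * ln (INR n)) in
  (r * cos (Im s * ln (INR n)), - (r * sin (Im s * ln (INR n)))).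

(** The n-th term (n >= 1, shifted to index k = n-1) of
    kappa_a(s,u) = sum_{n>=1} a_n n^{-s-conj u}. *)
Definition kterm (a : nat -> R) (s u : C) (k : nat) : C :=
  Cmult (RtoC (a (S k))) (npow (S k) (Cplus s (Cconj u))).

Definition kappa_conv (rho : R) (a : nat -> R) : Prop :=
  forall s u : C, rho < Re s -> rho < Re u -> ex_series (kterm a s u).

Definition kappa (a : nat -> R) (s u : C) : C :=
  (Series (fun k => Re (kterm a s u k)), Series (fun k => Im (kterm a s u k))).

Definition kfun {rho : R} (a : nat -> R) (t : C) : Fun rho :=
  fun s => kappa a (proj1_sig s) t.

Definition supp (a : nat -> R) (n : nat) : Prop := (1 <= n)%nat /\ a n <> 0.

Definition admissible (a : nat -> R) : Prop :=
  (forall N : nat, exists n, (N < n)%nat /\ supp a n) /\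
  (forall m n, supp a m -> supp a n -> supp a (m * n)) /\
  (exists p q, supp a p /\ supp a q /\ p <> 1%nat /\ q <> 1%nat /\ Nat.gcd p q = 1%nat).

Definition hnorm {rho : R} (ip : Fun rho -> Fun rho -> C) (f : Fun rho) : R :=
  sqrt (Re (ip f f)).

Definition hlim {rho : R} (ip : Fun rho -> Fun rho -> C) (fs : nat -> Fun rho) (g : Fun rho) : Prop :=
  forall eps, 0 < eps -> exists N, forall n, (N <= n)%nat -> hnorm ip (fsub (fs n) g) < eps.

Definition hcauchy {rho : R} (ip : Fun rho -> Fun rho -> C) (fs : nat -> Fun rho) : Prop :=
  forall eps, 0 < eps -> exists N, forall m n, (N <= m)%nat -> (N <= n)%nat ->
    hnorm ip (fsub (fs m) (fs n)) < eps.

Definition is_RKHS (rho : R) (a : nat -> R) (H : Fun rho -> Prop)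
    (ip : Fun rho -> Fun rho -> C) : Prop :=
  H fzero /\
  (forall f g, H f -> H g -> H (fadd f g)) /\
  (forall c f, H f -> H (fscal c f)) /\
  (forall f g h, H f -> H g -> H h -> ip (fadd f g) h = Cplus (ip f h) (ip g h)) /\
  (forall c f g, H f -> H g -> ip (fscal c f) g = Cmult c (ip f g)) /\
  (forall f g, H f -> H g -> ip g f = Cconj (ip f g)) /\
  (forall f, H f -> 0 <= Re (ip f f)) /\
  (forall f, H f -> ip f f = RtoC 0 -> f = fzero) /\
  (forall fs, (forall n, H (fs n)) -> hcauchy ip fs -> exists g, H g /\ hlim ip fs g) /\
  (forall t : Hrho rho, H (kfun a (proj1_sig t)) /\
     forall f, H f -> ip f (kfun a (proj1_sig t)) = f t).

Definition unitary {rho : R} (H : Fun rho -> Prop) (ip : Fun rho -> Fun rho -> C)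
    (U : Fun rho -> Fun rho) : Prop :=
  (forall f, H f -> H (U f)) /\
  (forall f g, H f -> H g -> U (fadd f g) = fadd (U f) (U g)) /\
  (forall c f, H f -> U (fscal c f) = fscal c (U f)) /\
  (forall f g, H f -> H g -> ip (U f) (U g) = ip f g) /\
  (forall g, H g -> exists f, H f /\ U f = g).

Definition densely_defined {rho : R} (H : Fun rho -> Prop) (ip : Fun rho -> Fun rho -> C)
    (D : Fun rho -> Prop) : Prop :=
  (forall f, D f -> H f) /\
  (forall h, H h -> forall eps, 0 < eps -> exists f, D f /\ hnorm ip (fsub h f) < eps).

Definition T_homogeneous {rho : R} (H : Fun rho -> Prop) (ip : Fun rho -> Fun rho -> C)
    (D : Fun rho -> Prop) (T : Fun rho -> Fun rho) : Prop :=
  densely_defined H ip D /\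
  forall c : R, exists U : Fun rho -> Fun rho,
    unitary H ip U /\
    (forall f, D f -> D (U f)) /\
    (forall f, D f -> U (T f) = fsub (T (U f)) (fscal (Cmult Ci (RtoC c)) (U f))).

Definition adj_dom {rho : R} (H : Fun rho -> Prop) (ip : Fun rho -> Fun rho -> C)
    (D : Fun rho -> Prop) (T : Fun rho -> Fun rho) (g : Fun rho) : Prop :=
  H g /\ exists h, H h /\ forall f, D f -> ip (T f) g = ip f h.

Definition closable {rho : R} (H : Fun rho -> Prop) (ip : Fun rho -> Fun rho -> C)
    (D : Fun rho -> Prop) (T : Fun rho -> Fun rho) : Prop :=
  exists (DS : Fun rho -> Prop) (S : Fun rho -> Fun rho),
    (forall f, DS f -> H f /\ H (S f)) /\
    (forall f g, DS f -> DS g -> DS (fadd f g) /\ S (fadd f g) = fadd (S f) (S g)) /\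
    (forall c f, DS f -> DS (fscal c f) /\ S (fscal c f) = fscal c (S f)) /\
    (forall f, D f -> DS f /\ S f = T f) /\
    (forall fs f g, (forall n, DS (fs n)) -> H f -> H g ->
       hlim ip fs f -> hlim ip (fun n => S (fs n)) g -> DS f /\ S f = g).

Definition kcomb (rho : R) (a : nat -> R) (alpha : R) (l : list (C * R)) : Fun rho :=
  fun s => fold_right (fun p acc => Cplus (Cmult (fst p) (kappa a (proj1_sig s) (alpha, snd p))) acc)
                      (RtoC 0) l.

Definition Tcomb (rho : R) (a : nat -> R) (alpha : R) (l : list (C * R)) : Fun rho :=
  fun s => fold_right (fun p acc =>
             Cplus (Cmult (fst p) (Cmult (Cmult Ci (RtoC (snd p))) (kappa a (proj1_sig s) (alpha, snd p)))) acc)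
                      (RtoC 0) l.

Definition Dspan (rho : R) (a : nat -> R) (alpha : R) (f : Fun rho) : Prop :=
  exists l, f = kcomb rho a alpha l.

(** T is (a function agreeing on D(T_alpha) with) the operator T_alpha defined by
    T_alpha kappa_{alpha+ib} = i b kappa_{alpha+ib}, extended linearly. *)
Definition T_def (rho : R) (a : nat -> R) (alpha : R) (T : Fun rho -> Fun rho) : Prop :=
  forall l, T (kcomb rho a alpha l) = Tcomb rho a alpha l.

(* Main.v *)
Require Import Defs.
From Stdlib Require Import Reals List Arith Lia Lra ZArith.
From Stdlib Require Import FunctionalExtensionality ProofIrrelevance ClassicalEpsilon.
From Coquelicot Require Import Coquelicot.
Open Scope R_scope.

(** Each [kappa_t] is a norm limit of combinations [T f_L] with [f_L -> 0].
    Cesaro averages over [b = k step], [L < k <= 2 L], of [n^{-ib} kappa_{alpha+ib}]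
    isolate the [n]-th term of the Dirichlet series of [kappa_{alpha}], provided
    [(m / n)^{i step} <> 1] for [m <> n]; dividing the coefficients by [ib] gives [f_L],
    of norm [O(1 / L)].  Hence [(0, kappa_t)] lies in the closure of the graph of
    [T_alpha], which is therefore not closable, and
    [<T f, g> = <f, h>] for all [f] forces [<kappa_t, g> = 0], that is [g = 0].
    With [h = 0] this also says that the span of the [kappa_{alpha+ib}] has trivial
    orthogonal complement.  The unitaries are the translations [f(s) -> f(s - ic)], and
    [T_alpha] is well defined since [n -> n^{ib}] are distinct characters of the
    multiplicative semigroup [supp a], two coprime elements sufficing to tell them apart. *)

(** The classical way to extract a coefficient is a mean over all real [b], but the domain holds
    only finite combinations, so the mean is sampled at multiples of one [step]. Sampling cannot
    tell [m] from [n] when [step * ln (m / n)] lies in [2 PI Z], and this is why the constant is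
    arithmetic. The averages tend to 0 for each [m <> n], but not uniformly in [m]:
    [(m / n)^{i step}] comes arbitrarily close to 1. Norm convergence therefore needs domination by
    [a_m m^{-2 alpha}]. Since [Re t] may differ from [alpha], the amplitudes [n^{alpha - Re t}] need
    not be summable, so the series of [kappa_t] is cut at [N] before averaging, and [N] is fixed
    before [L]. All norms are computed on Dirichlet coefficients: a combination of kernels with
    coefficients [a_n c_n] has squared norm [sum a_n |c_n|^2], which turns every estimate into one
    on weighted sequences. *)

(** * Finite and infinite complex sums *)

Definition lsum {A : Type} (F : A -> C) (l : list A) : C :=
  fold_right (fun x acc => Cplus (F x) acc) (RtoC 0) l.

Lemma lsum_nil {A : Type} (F : A -> C) : lsum F nil = RtoC 0.
Proof. reflexivity. Qed.

Lemma lsum_cons {A : Type} (F : A -> C) x l :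
  lsum F (x :: l) = Cplus (F x) (lsum F l).
Proof. reflexivity. Qed.

Lemma lsum_ext {A : Type} (F G : A -> C) l :
  (forall x, In x l -> F x = G x) -> lsum F l = lsum G l.
Proof.
  induction l as [|x l IH]; intros E; [reflexivity|].
  rewrite !lsum_cons, E, IH; simpl; auto; intros; apply E; now right.
Qed.

Lemma lsum_app {A : Type} (F : A -> C) l l' :
  lsum F (l ++ l') = Cplus (lsum F l) (lsum F l').
Proof.
  induction l as [|x l IH]; simpl app; rewrite ?lsum_cons, ?IH, ?lsum_nil; ring.
Qed.

Lemma lsum_map {A B : Type} (g : B -> A) (F : A -> C) l :
  lsum F (map g l) = lsum (fun x => F (g x)) l.
Proof. induction l; simpl map; rewrite ?lsum_cons, ?IHl; reflexivity. Qed.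

Lemma lsum_flat_map {A B : Type} (g : B -> list A) (F : A -> C) l :
  lsum F (flat_map g l) = lsum (fun x => lsum F (g x)) l.
Proof.
  induction l; simpl flat_map; rewrite ?lsum_app, ?lsum_cons, ?IHl; reflexivity.
Qed.

Lemma lsum_scal {A : Type} (c : C) (F : A -> C) l :
  lsum (fun x => Cmult c (F x)) l = Cmult c (lsum F l).
Proof. induction l; rewrite ?lsum_cons, ?IHl, ?lsum_nil; ring. Qed.

Lemma lsum_plus {A : Type} (F G : A -> C) l :
  lsum (fun x => Cplus (F x) (G x)) l = Cplus (lsum F l) (lsum G l).
Proof. induction l; rewrite ?lsum_cons, ?IHl, ?lsum_nil; ring. Qed.

Lemma Cmod_lsum_le {A : Type} (F : A -> C) (B : A -> R) l :
  (forall x, In x l -> Cmod (F x) <= B x) ->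
  Cmod (lsum F l) <= fold_right (fun x acc => B x + acc) 0 l.
Proof.
  induction l as [|x l IH]; intros E; [cbn; rewrite Cmod_0; lra|].
  rewrite lsum_cons; simpl fold_right.
  eapply Rle_trans; [apply Cmod_triangle|].
  apply Rplus_le_compat; [apply E; now left | apply IH; intros; apply E; now right].
Qed.

Lemma Cmod_lsum_le_length {A : Type} (F : A -> C) (B : R) l :
  (forall x, In x l -> Cmod (F x) <= B) ->
  Cmod (lsum F l) <= INR (length l) * B.
Proof.
  intros E; eapply Rle_trans; [apply (Cmod_lsum_le F (fun _ => B)), E|].
  clear E; induction l; simpl fold_right; simpl length; [simpl; lra|].
  rewrite S_INR; lra.
Qed.

(** Taken componentwise so that [kappa a s u] is [csum (kterm a s u)] by conversion. *)
Definition csum (x : nat -> C) : C :=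
  (Series (fun k => Re (x k)), Series (fun k => Im (x k))).

Definition csummable (x : nat -> C) : Prop := ex_series (fun k => Cmod (x k)).

Lemma csummable_le (x : nat -> C) (b : nat -> R) :
  (forall k, Cmod (x k) <= b k) -> ex_series b -> csummable x.
Proof.
  intros E; apply @ex_series_le; intros k.
  change (Rabs (Cmod (x k)) <= b k); rewrite Rabs_pos_eq; [apply E | apply Cmod_ge_0].
Qed.

Lemma csummable_Re x : csummable x -> ex_series (fun k => Re (x k)).
Proof. apply @ex_series_le; intros k; apply re_le_Cmod. Qed.

Lemma csummable_Im x : csummable x -> ex_series (fun k => Im (x k)).
Proof.
  apply @ex_series_le; intros k.
  eapply Rle_trans; [|apply Rmax_Cmod]; apply Rmax_r.
Qed.

Lemma csummable_plus x y :
  csummable x -> csummable y -> csummable (fun k => Cplus (x k) (y k)).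
Proof.
  intros Sx Sy; apply (csummable_le _ (fun k => Cmod (x k) + Cmod (y k))).
  - intros k; apply Cmod_triangle.
  - exact (ex_series_plus _ _ Sx Sy).
Qed.

Lemma csummable_scal c x : csummable x -> csummable (fun k => Cmult c (x k)).
Proof.
  intros Sx; apply (csummable_le _ (fun k => Cmod c * Cmod (x k))).
  - intros k; rewrite Cmod_mult; lra.
  - exact (ex_series_scal (Cmod c) _ Sx).
Qed.

Lemma csummable_zero : csummable (fun _ => RtoC 0).
Proof.
  apply (csummable_le _ (fun k => (/ 2) ^ k)).
  - intros k; rewrite Cmod_0; apply pow_le; lra.
  - apply ex_series_geom; rewrite Rabs_pos_eq; lra.
Qed.

Lemma csum_ext x y : (forall k, x k = y k) -> csum x = csum y.
Proof. intros E; unfold csum; f_equal; apply Series_ext; intros k; now rewrite E. Qed.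

Lemma csum_zero : csum (fun _ => RtoC 0) = RtoC 0.
Proof.
  unfold csum, RtoC; f_equal; simpl;
  (rewrite (Series_ext _ (fun _ => 0 * 0)) by (intros; simpl; ring); rewrite Series_scal_l; ring).
Qed.

Lemma csum_plus x y : csummable x -> csummable y ->
  csum (fun k => Cplus (x k) (y k)) = Cplus (csum x) (csum y).
Proof.
  intros Sx Sy; unfold csum, Cplus; simpl; f_equal; apply Series_plus;
    auto using csummable_Re, csummable_Im.
Qed.

Lemma csum_scal c x : csummable x ->
  csum (fun k => Cmult c (x k)) = Cmult c (csum x).
Proof.
  intros Sx; unfold csum, Cmult; simpl.
  rewrite <- !Series_scal_l, <- Series_minus, <- Series_plus; auto;
  first [apply (@ex_series_scal R_AbsRing R_NormedModule); auto using csummable_Re, csummable_Im].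
Qed.

Lemma csummable_lsum {A : Type} (x : A -> nat -> C) l :
  (forall p, In p l -> csummable (x p)) ->
  csummable (fun k => lsum (fun p => x p k) l).
Proof.
  induction l as [|p l IH]; intros E; [apply csummable_zero|].
  apply (csummable_plus (x p)); [apply E; now left | apply IH; intros; apply E; now right].
Qed.

Lemma csum_lsum {A : Type} (x : A -> nat -> C) l :
  (forall p, In p l -> csummable (x p)) ->
  csum (fun k => lsum (fun p => x p k) l) = lsum (fun p => csum (x p)) l.
Proof.
  induction l as [|p l IH]; intros E; [apply csum_zero|].
  rewrite lsum_cons, <- IH by (intros; apply E; now right).
  apply (csum_plus (x p)); [apply E; now left|].
  apply csummable_lsum; intros; apply E; now right.
Qed.

(** * Powers [n^{-s}] *)

Lemma npow_add n s t : npow n (Cplus s t) = Cmult (npow n s) (npow n t).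
Proof.
  destruct s as [s1 s2], t as [t1 t2]; unfold npow, Cmult; simpl.
  replace (- (s1 + t1) * ln (INR n)) with (- s1 * ln (INR n) + - t1 * ln (INR n)) by ring.
  rewrite Rmult_plus_distr_r, exp_plus, cos_plus, sin_plus; f_equal; ring.
Qed.

Lemma npow_conj n s : npow n (Cconj s) = Cconj (npow n s).
Proof.
  destruct s as [s1 s2]; unfold npow, Cconj; simpl.
  replace (- s2 * ln (INR n)) with (- (s2 * ln (INR n))) by ring.
  rewrite cos_neg, sin_neg; f_equal; ring.
Qed.

Lemma Cmod_npow n s : Cmod (npow n s) = exp (- Re s * ln (INR n)).
Proof.
  unfold npow, Cmod; simpl fst; simpl snd.
  set (r := exp _); set (x := Im s * _).
  replace ((r * cos x) ^ 2 + (- (r * sin x)) ^ 2)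
    with (r ^ 2 * (Rsqr (sin x) + Rsqr (cos x))) by (unfold Rsqr; ring).
  rewrite sin2_cos2, Rmult_1_r, <- Rsqr_pow2; apply sqrt_Rsqr; left; apply exp_pos.
Qed.

Lemma npow_neq0 n s : npow n s <> RtoC 0.
Proof. apply Cmod_gt_0; rewrite Cmod_npow; apply exp_pos. Qed.

Lemma npow_0 n : npow n (RtoC 0) = RtoC 1.
Proof.
  unfold npow; simpl.
  rewrite Ropp_0, !Rmult_0_l, exp_0, cos_0, sin_0; unfold RtoC; f_equal; ring.
Qed.

Lemma npow_mul m n s : (1 <= m)%nat -> (1 <= n)%nat ->
  npow (m * n) s = Cmult (npow m s) (npow n s).
Proof.
  intros Hm Hn; destruct s as [s1 s2]; unfold npow, Cmult; simpl.
  rewrite mult_INR, ln_mult by (apply lt_0_INR; lia).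
  rewrite !Rmult_plus_distr_l, exp_plus, cos_plus, sin_plus; f_equal; ring.
Qed.

(** * The Hilbert space *)

Lemma inv_S_small eps : 0 < eps ->
  exists N, forall n, (N <= n)%nat -> / (INR n + 1) < eps.
Proof.
  intros He; destruct (archimed_cor1 eps He) as [N [HN PN]].
  exists N; intros n Hn; eapply Rle_lt_trans; [|exact HN].
  apply Rinv_le_contravar; [now apply lt_0_INR|].
  apply le_INR in Hn; lra.
Qed.

Lemma inv_S_pos n : 0 < / (INR n + 1).
Proof. apply Rinv_0_lt_compat; pose proof (pos_INR n); lra. Qed.

Section Hilbert.

Context {rho : R} {a : nat -> R} {H : Fun rho -> Prop} {ip : Fun rho -> Fun rho -> C}
        (HK : is_RKHS rho a H ip).

Lemma H_zero : H fzero.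
Proof. apply HK. Qed.

Lemma H_add f g : H f -> H g -> H (fadd f g).
Proof. apply HK. Qed.

Lemma H_scal c f : H f -> H (fscal c f).
Proof. apply HK. Qed.

Lemma H_complete fs :
  (forall n, H (fs n)) -> hcauchy ip fs -> exists g, H g /\ hlim ip fs g.
Proof. apply HK. Qed.

Lemma H_kfun (t : Hrho rho) : H (kfun a (proj1_sig t)).
Proof. apply HK. Qed.

Lemma ip_kfun (t : Hrho rho) f : H f -> ip f (kfun a (proj1_sig t)) = f t.
Proof. apply HK. Qed.

Lemma ip_add_l f g h : H f -> H g -> H h -> ip (fadd f g) h = Cplus (ip f h) (ip g h).
Proof. apply HK. Qed.

Lemma ip_scal_l c f g : H f -> H g -> ip (fscal c f) g = Cmult c (ip f g).
Proof. apply HK. Qed.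

Lemma ip_conj f g : H f -> H g -> ip g f = Cconj (ip f g).
Proof. apply HK. Qed.

Lemma ip_pos f : H f -> 0 <= Re (ip f f).
Proof. apply HK. Qed.

Lemma ip_definite f : H f -> ip f f = RtoC 0 -> f = fzero.
Proof. apply HK. Qed.

Lemma fsub_fadd (f g : Fun rho) : fsub f g = fadd f (fscal (Copp (RtoC 1)) g).
Proof.
  apply functional_extensionality; intros s; unfold fsub, fadd, fscal.
  ring.
Qed.

Lemma H_sub f g : H f -> H g -> H (fsub f g).
Proof. intros; rewrite fsub_fadd; auto using H_add, H_scal. Qed.

Lemma ip_add_r f g h : H f -> H g -> H h -> ip h (fadd f g) = Cplus (ip h f) (ip h g).
Proof.
  intros; rewrite (ip_conj (fadd f g) h), ip_add_l, Cplus_conj, <- !ip_conj; auto using H_add.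
Qed.

Lemma ip_scal_r c f g : H f -> H g -> ip g (fscal c f) = Cmult (Cconj c) (ip g f).
Proof.
  intros; rewrite (ip_conj (fscal c f) g), ip_scal_l, Cmult_conj, <- ip_conj; auto using H_scal.
Qed.

Lemma ip_sub_l f g h : H f -> H g -> H h -> ip (fsub f g) h = Cminus (ip f h) (ip g h).
Proof.
  intros; rewrite fsub_fadd, ip_add_l, ip_scal_l; auto using H_scal; ring.
Qed.

Lemma ip_sub_r f g h : H f -> H g -> H h -> ip h (fsub f g) = Cminus (ip h f) (ip h g).
Proof.
  intros; rewrite (ip_conj (fsub f g) h), ip_sub_l, Cminus_conj, <- !ip_conj; auto using H_sub.
Qed.

Lemma hnorm_ge_0 f : 0 <= hnorm ip f.
Proof. apply sqrt_pos. Qed.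

Lemma hnorm_sqr f : H f -> hnorm ip f ^ 2 = Re (ip f f).
Proof. intros Hf; apply pow2_sqrt, ip_pos, Hf. Qed.

Lemma ip_self f : H f -> ip f f = RtoC (hnorm ip f ^ 2).
Proof.
  intros Hf; rewrite hnorm_sqr by easy.
  pose proof (ip_conj f f Hf Hf) as E.
  destruct (ip f f) as [x y]; injection E; intros E'; unfold RtoC; simpl; f_equal; lra.
Qed.

Lemma hnorm_eq_0 f : H f -> hnorm ip f = 0 -> f = fzero.
Proof.
  intros Hf E; apply ip_definite; [easy|]; rewrite ip_self, E by easy; f_equal; ring.
Qed.

Lemma hnorm_zero : hnorm ip fzero = 0.
Proof.
  replace (@fzero rho) with (fscal (RtoC 0) (@fzero rho)).
  - unfold hnorm; rewrite ip_scal_l, Cmult_0_l by auto using H_zero, H_scal; apply sqrt_0.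
  - apply functional_extensionality; intros s; unfold fscal; apply Cmult_0_l.
Qed.

Lemma hnorm_scal c f : H f -> hnorm ip (fscal c f) = Cmod c * hnorm ip f.
Proof.
  intros Hf; unfold hnorm at 1.
  rewrite ip_scal_l, ip_scal_r, Cmult_assoc, <- Cmod2_conj, ip_self by auto using H_scal.
  rewrite <- RtoC_mult, <- Rpow_mult_distr; simpl Re.
  apply sqrt_pow2, Rmult_le_pos; [apply Cmod_ge_0 | apply hnorm_ge_0].
Qed.

Lemma hnorm_sub_sqr f g : H f -> H g ->
  hnorm ip (fsub f g) ^ 2 = hnorm ip f ^ 2 - 2 * Re (ip f g) + hnorm ip g ^ 2.
Proof.
  intros Hf Hg; rewrite !hnorm_sqr by auto using H_sub.
  rewrite ip_sub_l, !ip_sub_r, (ip_conj f g) by auto using H_sub.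
  unfold Cminus, Cplus, Copp, Cconj, Re; simpl; ring.
Qed.

Lemma hnorm_add_sqr f g : H f -> H g ->
  hnorm ip (fadd f g) ^ 2 = hnorm ip f ^ 2 + 2 * Re (ip f g) + hnorm ip g ^ 2.
Proof.
  intros Hf Hg; rewrite !hnorm_sqr by auto using H_add.
  rewrite ip_add_l, !ip_add_r, (ip_conj f g) by auto using H_add.
  unfold Cplus, Cconj, Re; simpl; ring.
Qed.

Lemma Cauchy_Schwarz f g : H f -> H g -> Cmod (ip f g) <= hnorm ip f * hnorm ip g.
Proof.
  intros Hf Hg.
  destruct (Req_dec (hnorm ip g) 0) as [E|E].
  - rewrite (hnorm_eq_0 g Hg E), hnorm_zero, Rmult_0_r.
    replace (@fzero rho) with (fscal (RtoC 0) f).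
    + rewrite ip_scal_r, Cmod_mult, Cmod_conj, Cmod_0 by easy; lra.
    + apply functional_extensionality; intros s; apply Cmult_0_l.
  - pose proof (hnorm_ge_0 f) as Pf; pose proof (hnorm_ge_0 g) as Pg.
    set (N := hnorm ip g) in *; set (F := hnorm ip f) in *; set (y := ip f g).
    (* [N^2 f - <f,g> g] is [N^2] times the component of [f] orthogonal to [g]; scaling by [N^2]
       avoids a division. *)
    pose proof (ip_pos (fsub (fscal (RtoC (N ^ 2)) f) (fscal y g))
                  ltac:(auto using H_sub, H_scal)) as P.
    rewrite <- hnorm_sqr, hnorm_sub_sqr, !hnorm_scal, ip_scal_l, ip_scal_r in P
      by auto using H_sub, H_scal.
    fold y N F in P.
    rewrite (Cmult_comm (Cconj y)), <- Cmod2_conj, <- RtoC_mult, Cmod_R in P.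
    rewrite (Rabs_pos_eq (N ^ 2)) in P by apply pow2_ge_0; simpl Re in P.
    pose proof (Cmod_ge_0 y) as Py.
    apply Rsqr_incr_0_var; [rewrite !Rsqr_pow2|nra].
    assert (0 < N ^ 2) by nra.
    apply Rmult_le_reg_l with (N ^ 2); nra.
Qed.

Lemma hnorm_add_le f g : H f -> H g ->
  hnorm ip (fadd f g) <= hnorm ip f + hnorm ip g.
Proof.
  intros Hf Hg; pose proof (hnorm_ge_0 f); pose proof (hnorm_ge_0 g).
  apply Rsqr_incr_0_var; [rewrite !Rsqr_pow2|lra].
  rewrite hnorm_add_sqr by easy.
  pose proof (Cauchy_Schwarz f g Hf Hg).
  pose proof (Rle_trans _ _ _ (Rle_abs _) (re_le_Cmod (ip f g))); nra.
Qed.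

Lemma hnorm_sub_sym f g : H f -> H g -> hnorm ip (fsub f g) = hnorm ip (fsub g f).
Proof.
  intros Hf Hg.
  replace (fsub f g) with (fscal (Copp (RtoC 1)) (fsub g f)).
  - rewrite hnorm_scal, Cmod_m1 by auto using H_sub; ring.
  - apply functional_extensionality; intros s; unfold fsub, fscal; ring.
Qed.

Lemma hnorm_sub_triangle f g h : H f -> H g -> H h ->
  hnorm ip (fsub f h) <= hnorm ip (fsub f g) + hnorm ip (fsub g h).
Proof.
  intros Hf Hg Hh.
  replace (fsub f h) with (fadd (fsub f g) (fsub g h)).
  - apply hnorm_add_le; auto using H_sub.
  - apply functional_extensionality; intros s; unfold fsub, fadd; ring.
Qed.

Lemma Cmod_eval_le (t : Hrho rho) f : H f ->
  Cmod (f t) <= hnorm ip f * hnorm ip (kfun (rho := rho) a (proj1_sig t)).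
Proof. intros Hf; rewrite <- ip_kfun by easy; apply Cauchy_Schwarz; auto using H_kfun. Qed.

(** Point evaluations are bounded by the norm of the kernel function. This identifies a limit found
    by completeness with a function known pointwise. *)
Lemma hlim_eval fs f : (forall n, H (fs n)) -> H f -> hlim ip fs f ->
  forall t eps, 0 < eps -> exists N, forall n, (N <= n)%nat -> Cmod (Cminus (fs n t) (f t)) < eps.
Proof.
  intros Hfs Hf L t eps He.
  set (K := hnorm ip (kfun (rho := rho) a (proj1_sig t))).
  assert (PK : 0 <= K) by apply hnorm_ge_0.
  destruct (L (eps / (K + 1))) as [N HN]; [apply Rdiv_lt_0_compat; lra|].
  exists N; intros n Hn; specialize (HN n Hn).
  eapply Rle_lt_trans; [apply (Cmod_eval_le t (fsub (fs n) f)); auto using H_sub|].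
  fold K; pose proof (hnorm_ge_0 (fsub (fs n) f)).
  apply Rle_lt_trans with (hnorm ip (fsub (fs n) f) * (K + 1)); [nra|].
  replace eps with (eps / (K + 1) * (K + 1)) by (field; lra).
  apply Rmult_lt_compat_r; lra.
Qed.

(** Correcting [f] by [(x / V^2) v], the best move along [v], lowers the squared distance to [h] by
    [|x|^2 / V^2]. As [f] is within [eps^2] of the infimum, this gain is at most [eps^2]. *)
Lemma near_minimizer_almost_orthogonal (D : Fun rho -> Prop) h f v d eps :
  (forall u, D u -> H u) ->
  (forall u w, D u -> D w -> D (fadd u w)) ->
  (forall c u, D u -> D (fscal c u)) ->
  H h -> D f -> D v -> 0 <= eps ->
  (forall u, D u -> d <= hnorm ip (fsub h u) ^ 2) ->
  hnorm ip (fsub h f) ^ 2 <= d + eps ^ 2 ->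
  Cmod (ip (fsub h f) v) <= eps * hnorm ip v.
Proof.
  intros DH Dadd Dscal Hh Df Dv Pe Hd Hf.
  assert (Hhf : H (fsub h f)) by auto using H_sub.
  pose proof (hnorm_ge_0 v) as Pv.
  set (x := ip (fsub h f) v); set (V := hnorm ip v) in *.
  destruct (Req_dec V 0) as [E|E].
  - unfold x; eapply Rle_trans; [apply Cauchy_Schwarz; auto|].
    fold V; rewrite E; lra.
  - specialize (Hd _ (Dadd _ _ Df (Dscal (Cmult (RtoC (/ V ^ 2)) x) _ Dv))).
    replace (fsub h (fadd f _)) with (fsub (fsub h f) (fscal (Cmult (RtoC (/ V ^ 2)) x) v)) in Hd
      by (apply functional_extensionality; intros s; unfold fsub, fadd, fscal; ring).
    rewrite hnorm_sub_sqr, ip_scal_r, hnorm_scal, Cmult_conj in Hd by auto using H_scal.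
    fold x V in Hd.
    rewrite <- Cmult_assoc, (Cmult_comm (Cconj x)), <- Cmod2_conj, Cmod_mult, Cmod_R in Hd.
    replace (Cconj (RtoC (/ V ^ 2))) with (RtoC (/ V ^ 2)) in Hd
      by (unfold Cconj, RtoC; simpl; f_equal; ring).
    rewrite <- RtoC_mult in Hd; cbn [Re RtoC fst] in Hd.
    assert (P2 : 0 < V ^ 2) by nra.
    rewrite Rabs_pos_eq in Hd by (left; apply Rinv_0_lt_compat, P2).
    replace ((/ V ^ 2 * Cmod x * V) ^ 2) with (/ V ^ 2 * Cmod x ^ 2) in Hd by (field; exact E).
    assert (Q : / V ^ 2 * Cmod x ^ 2 <= eps ^ 2) by lra.
    apply (Rmult_le_compat_l (V ^ 2)) in Q; [|lra].
    rewrite <- Rmult_assoc, Rinv_r, Rmult_1_l in Q by lra.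
    apply Rsqr_incr_0_var; [rewrite !Rsqr_pow2 | apply Rmult_le_pos; lra].
    rewrite Rpow_mult_distr; lra.
Qed.

(** The projection argument, run on a subspace that is not closed: a minimizing sequence for the
    distance from [h] to [D] is Cauchy, its limit [g] satisfies [h - g] orthogonal to [D], and so
    [h = g] is a limit of elements of [D]. *)
Lemma dense_of_trivial_orthogonal (D : Fun rho -> Prop) :
  (forall u, D u -> H u) -> D fzero ->
  (forall u w, D u -> D w -> D (fadd u w)) ->
  (forall c u, D u -> D (fscal c u)) ->
  (forall h, H h -> (forall v, D v -> ip h v = RtoC 0) -> h = fzero) ->
  densely_defined H ip D.
Proof.
  intros DH D0 Dadd Dscal Dorth; split; [exact DH|]; intros h Hh.
  (* [completeness] yields least upper bounds, so the squared distances are negated: their infimum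
     is [- m]. *)
  destruct (completeness (fun x => exists u, D u /\ x = - hnorm ip (fsub h u) ^ 2))
    as [m [Hm1 Hm2]].
  { exists 0; intros x [u [_ ->]]; nra. }
  { now exists (- hnorm ip (fsub h fzero) ^ 2), fzero. }
  assert (Hd : forall u, D u -> - m <= hnorm ip (fsub h u) ^ 2).
  { intros u Du; assert (- hnorm ip (fsub h u) ^ 2 <= m) by (apply Hm1; eauto); lra. }
  assert (Hmin : forall n, exists u, D u /\ hnorm ip (fsub h u) ^ 2 <= - m + (/ (INR n + 1)) ^ 2).
  { intros n; apply NNPP; intros Hn.
    pose proof (pow_lt _ 2 (inv_S_pos n)).
    assert (m <= m - (/ (INR n + 1)) ^ 2); [|lra].
    apply Hm2; intros x [u [Du ->]].
    apply Rnot_lt_le; intros L; apply Hn; exists u; split; [easy|lra]. }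
  pose (fs n := proj1_sig (constructive_indefinite_description _ (Hmin n))).
  assert (Hfs : forall n, D (fs n) /\ hnorm ip (fsub h (fs n)) ^ 2 <= - m + (/ (INR n + 1)) ^ 2)
    by (intros n; exact (proj2_sig (constructive_indefinite_description _ (Hmin n)))).
  clearbody fs.
  assert (HfsH : forall n, H (fs n)) by (intros n; apply DH, Hfs).
  assert (Orth : forall n v, D v ->
            Cmod (ip (fsub h (fs n)) v) <= / (INR n + 1) * hnorm ip v).
  { intros n v Dv; apply (near_minimizer_almost_orthogonal D) with (- m);
      try easy; try apply Hfs; left; apply inv_S_pos. }
  destruct (H_complete fs HfsH) as [g [Hg L]].
  { intros eps He; destruct (inv_S_small (eps / 2)) as [N HN]; [lra|].
    exists N; intros i j Hi Hj; specialize (HN _ Hi) as Bi; specialize (HN _ Hj) as Bj.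
    set (v := fsub (fs i) (fs j)).
    assert (Dv : D v) by (unfold v; rewrite fsub_fadd; apply Dadd, Dscal; apply Hfs).
    assert (E : hnorm ip v ^ 2 = Re (ip v v)) by apply hnorm_sqr, DH, Dv.
    (* Both residuals are almost orthogonal to the difference [v] of two members of the sequence, so
       [|v|^2] is at most [(1/(i+1) + 1/(j+1)) |v|]. The parallelogram law is not called upon. *)
    assert (Ev : ip v v = Cminus (ip (fsub h (fs j)) v) (ip (fsub h (fs i)) v)).
    { rewrite <- ip_sub_l by auto using H_sub; f_equal.
      apply functional_extensionality; intros s; unfold v, fsub; ring. }
    pose proof (Cmod_triangle (ip (fsub h (fs j)) v) (Copp (ip (fsub h (fs i)) v))) as T.
    fold (Cminus (ip (fsub h (fs j)) v) (ip (fsub h (fs i)) v)) in T.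
    rewrite <- Ev, Cmod_opp in T.
    pose proof (Rle_trans _ _ _ (Rle_abs _) (re_le_Cmod (ip v v))).
    pose proof (Orth i v Dv); pose proof (Orth j v Dv).
    pose proof (hnorm_ge_0 v).
    apply Rnot_le_lt; intros Hle; nra. }
  assert (E : fsub h g = fzero).
  { apply Dorth; [auto using H_sub|]; intros v Dv.
    apply Cmod_eq_0, Rle_antisym; [|apply Cmod_ge_0].
    apply le_epsilon; intros eps He; rewrite Rplus_0_l.
    pose proof (hnorm_ge_0 v) as Pv; set (V := hnorm ip v) in *.
    assert (He' : 0 < eps / (2 * (V + 1))) by (apply Rdiv_lt_0_compat; lra).
    destruct (inv_S_small _ He') as [N HN]; destruct (L _ He') as [N' HN'].
    specialize (HN (N + N')%nat ltac:(lia)); specialize (HN' (N + N')%nat ltac:(lia)).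
    set (n := (N + N')%nat) in *.
    replace (fsub h g) with (fadd (fsub h (fs n)) (fsub (fs n) g))
      by (apply functional_extensionality; intros s; unfold fadd, fsub; ring).
    rewrite ip_add_l by auto using H_sub.
    eapply Rle_trans; [apply Cmod_triangle|].
    pose proof (Orth n v Dv) as B1.
    pose proof (Cauchy_Schwarz (fsub (fs n) g) v ltac:(auto using H_sub) (DH _ Dv)) as B2.
    fold V in B1, B2.
    apply Rle_trans with (eps / (2 * (V + 1)) * V + eps / (2 * (V + 1)) * V).
    - apply Rplus_le_compat; (eapply Rle_trans; [eassumption|]);
        apply Rmult_le_compat_r; lra.
    - replace eps with (eps / (2 * (V + 1)) * (V + 1) + eps / (2 * (V + 1)) * (V + 1)) at 3
        by (field; lra).
      nra. }
  intros eps He; destruct (L eps He) as [N HN].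
  exists (fs N); split; [apply Hfs|].
  replace h with g.
  - rewrite hnorm_sub_sym; auto.
  - apply functional_extensionality; intros s.
    pose proof (f_equal (fun F => F s) E) as Es; unfold fsub, fzero in Es.
    replace (h s) with (Cplus (Cminus (h s) (g s)) (g s)) by ring.
    rewrite Es; ring.
Qed.

End Hilbert.

(** * Norms of combinations of kernel functions *)

Lemma ex_series_Re (x : nat -> C) :
  @ex_series C_AbsRing C_NormedModule x -> ex_series (fun k => Re (x k)).
Proof.
  intros [l Hl]; exists (Re l).
  apply filterlim_ext with (fun n => fst (@sum_n C_AbelianMonoid x n)).
  - intros n; induction n as [|n IH]; [now rewrite !sum_O|].
    now rewrite !sum_Sn, <- IH.
  - apply (filterlim_comp _ _ _ _ _ _ _ _ Hl).
    intros P [eps HP]; exists eps; intros y Hy; apply HP, Hy.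
Qed.

(** The terms of [kappa_a(t,t)], the squared norm of [kappa_t], for any [t] with real part [sigma];
    index [k] stands for [n = k + 1]. *)
Definition weight (a : nat -> R) (sigma : R) (k : nat) : R :=
  a (S k) * exp (- (2 * sigma) * ln (INR (S k))).

Definition gcomb {rho : R} (a : nat -> R) (l : list (C * C)) : Fun rho :=
  fun s => lsum (fun p => Cmult (fst p) (kappa a (proj1_sig s) (snd p))) l.

(** The Dirichlet coefficients of [gcomb a l] are [a n * symbol l n]. *)
Definition symbol (l : list (C * C)) (n : nat) : C :=
  lsum (fun p => Cmult (fst p) (npow n (Cconj (snd p)))) l.

Definition in_half_plane (rho : R) (l : list (C * C)) : Prop :=
  forall p, In p l -> rho < Re (snd p).

Section Kernel.

Context {rho : R} {a : nat -> R}
        (Ha : forall n, (1 <= n)%nat -> 0 <= a n) (Hconv : kappa_conv rho a).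

Lemma weight_ge_0 sigma k : 0 <= weight a sigma k.
Proof. apply Rmult_le_pos; [apply Ha; lia | left; apply exp_pos]. Qed.

(** At [s = u = sigma] the terms of the kernel are non-negative reals. Hence the mere convergence in
    [kappa_conv] becomes absolute convergence on the whole domain, by [Cmod_kterm]. *)
Lemma ex_series_weight sigma : rho < sigma -> ex_series (weight a sigma).
Proof.
  intros Hs.
  apply ex_series_ext with (fun k => Re (kterm a (RtoC sigma) (RtoC sigma) k)).
  - intros k; change (Re (kterm a sigma sigma k) = weight a sigma k).
    unfold weight, kterm, npow.
    cbn [Re Im Cmult Cplus Cconj RtoC fst snd].
    rewrite Ropp_0, Rplus_0_l, Rmult_0_l, cos_0.
    replace (2 * sigma) with (sigma + sigma) by ring; ring.
  - apply ex_series_Re, Hconv; easy.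
Qed.

Lemma Cmod_kterm s u k :
  Cmod (kterm a s u k) = weight a ((Re s + Re u) / 2) k.
Proof.
  unfold kterm, weight; rewrite Cmod_mult, Cmod_R, Rabs_pos_eq, Cmod_npow by (apply Ha; lia).
  do 2 f_equal; destruct s, u; simpl; field.
Qed.

Lemma csummable_kterm s u : rho < Re s -> rho < Re u -> csummable (kterm a s u).
Proof.
  intros Hs Hu; apply (csummable_le _ (weight a ((Re s + Re u) / 2))).
  - intros k; rewrite Cmod_kterm; lra.
  - apply ex_series_weight; lra.
Qed.

Lemma csummable_symbol l s : in_half_plane rho l -> rho < Re s ->
  csummable (fun k => Cmult (RtoC (a (S k))) (Cmult (npow (S k) s) (symbol l (S k)))).
Proof.
  intros Hl Hs.
  apply (csummable_le _ (fun k => Cmod (lsum (fun p => Cmult (fst p) (kterm a s (snd p) k)) l))).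
  - intros k; right; f_equal; unfold symbol.
    rewrite <- !lsum_scal; apply lsum_ext; intros p _.
    unfold kterm; rewrite npow_add; ring.
  - apply (csummable_lsum (fun p k => Cmult (fst p) (kterm a s (snd p) k))).
    intros p Hp; apply csummable_scal, csummable_kterm; auto.
Qed.

Lemma gcomb_csum l (s : Hrho rho) : in_half_plane rho l ->
  gcomb a l s = csum (fun k => Cmult (RtoC (a (S k)))
                       (Cmult (npow (S k) (proj1_sig s)) (symbol l (S k)))).
Proof.
  intros Hl; destruct s as [s Hs]; unfold gcomb; simpl proj1_sig.
  transitivity (csum (fun k => lsum (fun p => Cmult (fst p) (kterm a s (snd p) k)) l)).
  - rewrite csum_lsum.
    + apply lsum_ext; intros p Hp.
      rewrite csum_scal by (apply csummable_kterm; auto); reflexivity.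
    + intros p Hp; apply csummable_scal, csummable_kterm; auto.
  - apply csum_ext; intros k; unfold symbol.
    rewrite <- !lsum_scal; apply lsum_ext; intros p _.
    unfold kterm; rewrite npow_add; ring.
Qed.

Context {H : Fun rho -> Prop} {ip : Fun rho -> Fun rho -> C} (HK : is_RKHS rho a H ip).

Lemma gcomb_cons p l :
  @gcomb rho a (p :: l) = fadd (fscal (fst p) (kfun a (snd p))) (gcomb a l).
Proof. reflexivity. Qed.

Lemma H_gcomb l : in_half_plane rho l -> H (gcomb a l).
Proof.
  induction l as [|p l IH]; intros Hl; [apply (H_zero HK)|].
  rewrite gcomb_cons; apply (H_add HK).
  - apply (H_scal HK).
    apply (H_kfun HK (exist _ (snd p) (Hl p (or_introl eq_refl)))).
  - apply IH; intros q Hq; apply Hl; now right.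
Qed.

Lemma gcomb_nil : @gcomb rho a nil = fscal (RtoC 0) (@fzero rho).
Proof. apply functional_extensionality; intros s; symmetry; apply Cmult_0_l. Qed.

(** Induction on [l']: the reproducing property turns the product with one kernel into a value of
    [gcomb a l], which is a Dirichlet series by [gcomb_csum]. Summability belongs to the statement
    because adding two series requires it at each step. *)
Lemma ip_gcomb l l' : in_half_plane rho l -> in_half_plane rho l' ->
  let x k := Cmult (RtoC (a (S k))) (Cmult (symbol l (S k)) (Cconj (symbol l' (S k)))) in
  csummable x /\ ip (gcomb a l) (gcomb a l') = csum x.
Proof.
  intros Hl Hl' x; subst x; pose proof (H_gcomb l Hl) as Hf.
  induction l' as [|p l' IH].
  - assert (E : forall k, RtoC 0 =
      Cmult (RtoC (a (S k))) (Cmult (symbol l (S k)) (Cconj (symbol nil (S k))))).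
    { intros k; replace (Cconj (symbol nil (S k))) with (RtoC 0); [ring|].
      unfold symbol, Cconj; simpl; unfold RtoC; f_equal; ring. }
    split.
    + eapply ex_series_ext; [|apply csummable_zero]; intros k; cbv beta; now rewrite <- E.
    + rewrite <- (csum_ext _ _ E), csum_zero, gcomb_nil, (ip_scal_r HK)
        by (easy || apply (H_zero HK)).
      replace (Cconj (RtoC 0)) with (RtoC 0) by (unfold Cconj, RtoC; simpl; f_equal; ring).
      apply Cmult_0_l.
  - assert (Hp : rho < Re (snd p)) by (apply Hl'; now left).
    assert (Hl'' : in_half_plane rho l') by (intros q Hq; apply Hl'; now right).
    destruct (IH Hl'') as [S1 E1].
    pose proof (csummable_symbol l (snd p) Hl Hp) as S2.
    pose proof (csummable_scal (Cconj (fst p)) _ S2) as S3.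
    assert (E : forall k,
      Cplus (Cmult (Cconj (fst p)) (Cmult (RtoC (a (S k)))
                (Cmult (npow (S k) (snd p)) (symbol l (S k)))))
            (Cmult (RtoC (a (S k))) (Cmult (symbol l (S k)) (Cconj (symbol l' (S k))))) =
      Cmult (RtoC (a (S k))) (Cmult (symbol l (S k)) (Cconj (symbol (p :: l') (S k))))).
    { intros k; unfold symbol; rewrite lsum_cons, Cplus_conj, Cmult_conj.
      rewrite npow_conj, Cconj_conj; ring. }
    split.
    + eapply ex_series_ext; [|apply (csummable_plus _ _ S3 S1)].
      intros k; cbv beta; now rewrite E.
    + pose proof (H_kfun HK (exist _ (snd p) Hp)) as Hk; simpl in Hk.
      pose proof (H_scal HK (fst p)).
      rewrite gcomb_cons, (ip_add_r HK), (ip_scal_r HK), E1 by auto using H_gcomb.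
      pose proof (ip_kfun HK (exist _ (snd p) Hp) _ Hf) as E2; simpl in E2.
      rewrite E2, gcomb_csum by easy; simpl proj1_sig.
      rewrite <- csum_scal, <- csum_plus by easy; apply csum_ext, E.
Qed.

Lemma hnorm_gcomb l : in_half_plane rho l ->
  ex_series (fun k => a (S k) * Cmod (symbol l (S k)) ^ 2) /\
  hnorm ip (gcomb a l) ^ 2 = Series (fun k => a (S k) * Cmod (symbol l (S k)) ^ 2).
Proof.
  intros Hl; destruct (ip_gcomb l l Hl Hl) as [S1 E1].
  assert (E : forall k, Re (Cmult (RtoC (a (S k)))
      (Cmult (symbol l (S k)) (Cconj (symbol l (S k))))) = a (S k) * Cmod (symbol l (S k)) ^ 2).
  { intros k; rewrite <- Cmod2_conj, <- RtoC_mult; reflexivity. }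
  split.
  - apply (ex_series_ext _ _ E), csummable_Re, S1.
  - rewrite (hnorm_sqr HK), E1 by now apply H_gcomb.
    apply Series_ext, E.
Qed.

End Kernel.

(** * Independence of the vertical characters *)

Lemma exp_ln_pow n k : (1 <= n)%nat -> exp (INR k * ln (INR n)) = INR (n ^ k).
Proof.
  intros Hn; assert (0 < INR n) by (apply lt_0_INR; lia).
  rewrite <- ln_pow, exp_ln, pow_INR; auto; now apply pow_lt.
Qed.

Lemma coprime_powers_distinct p q j k : Nat.gcd p q = 1%nat -> p <> 1%nat ->
  (0 < j)%nat -> (p ^ j)%nat <> (q ^ k)%nat.
Proof.
  intros G Hp Hj E; apply Hp.
  assert (D : Nat.divide p (q ^ k)).
  { rewrite <- E; destruct j as [|j]; [lia|]; exists (p ^ j)%nat; simpl; lia. }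
  clear E; induction k as [|k IH].
  - now apply Nat.divide_1_r.
  - apply IH, (Nat.gauss _ q); [exact D | exact G].
Qed.

(** The hypotheses put [d ln p] and [d ln q] in [PI Z]. If [d <> 0], then [ln p / ln q] is rational
    and a positive power of [p] is a power of [q], against coprimality. *)
Lemma log_lattice_trivial p q d : (1 < p)%nat -> (1 < q)%nat -> Nat.gcd p q = 1%nat ->
  sin (d * ln (INR p)) = 0 -> sin (d * ln (INR q)) = 0 -> d = 0.
Proof.
  intros Hp Hq G Sp Sq.
  assert (Lp : 0 < ln (INR p)) by (rewrite <- ln_1; apply ln_increasing; [lra|now apply (lt_INR 1)]).
  assert (Lq : 0 < ln (INR q)) by (rewrite <- ln_1; apply ln_increasing; [lra|now apply (lt_INR 1)]).
  apply sin_eq_0_0 in Sp; destruct Sp as [j Ej].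
  apply sin_eq_0_0 in Sq; destruct Sq as [k Ek].
  apply NNPP; intros Hd; pose proof PI_RGT_0 as PP.
  assert (E : IZR k * ln (INR p) = IZR j * ln (INR q)).
  { apply (Rmult_eq_reg_l (d * PI)); [|apply Rmult_integral_contrapositive; lra].
    transitivity (d * ln (INR p) * (IZR k * PI)); [ring|].
    rewrite Ej, <- Ek; ring. }
  assert (Hk : k <> 0%Z).
  { intros ->; rewrite Rmult_0_l in Ek; apply Rmult_integral in Ek; lra. }
  (* Both logarithms are positive, so absolute values give natural exponents. *)
  assert (E' : INR (Z.abs_nat k) * ln (INR p) = INR (Z.abs_nat j) * ln (INR q)).
  { rewrite (INR_IZR_INZ (Z.abs_nat k)), (INR_IZR_INZ (Z.abs_nat j)), !Nat2Z.inj_abs_nat, !abs_IZR.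
    rewrite <- (Rabs_pos_eq (ln (INR p))), <- (Rabs_pos_eq (ln (INR q))) by lra.
    rewrite <- !Rabs_mult; now f_equal. }
  apply (coprime_powers_distinct p q (Z.abs_nat k) (Z.abs_nat j)); [easy|lia|lia|].
  apply INR_eq; rewrite <- !exp_ln_pow by lia; now f_equal.
Qed.

(** A single base [n] determines [b] only modulo [2 PI / ln n]; two coprime bases remove the
    ambiguity. *)
Lemma npow_vertical_injective alpha p q b b' :
  (1 < p)%nat -> (1 < q)%nat -> Nat.gcd p q = 1%nat ->
  npow p (Cconj (alpha, b)) = npow p (Cconj (alpha, b')) ->
  npow q (Cconj (alpha, b)) = npow q (Cconj (alpha, b')) -> b = b'.
Proof.
  intros Hp Hq G Ep Eq.
  assert (K : forall n, npow n (Cconj (alpha, b)) = npow n (Cconj (alpha, b')) ->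
                sin ((b - b') * ln (INR n)) = 0).
  { intros n E; injection E; intros E2 E1.
    pose proof (exp_pos (- alpha * ln (INR n))) as P.
    apply Rmult_eq_reg_l in E1; [|simpl in *; lra].
    apply Ropp_eq_compat in E2; rewrite !Ropp_involutive in E2.
    apply Rmult_eq_reg_l in E2; [|simpl in *; lra].
    simpl in E1, E2.
    replace ((b - b') * ln (INR n)) with (- b' * ln (INR n) - - b * ln (INR n)) by ring.
    rewrite sin_minus, E1, E2; ring. }
  apply Rminus_diag_uniq, (log_lattice_trivial p q); auto.
Qed.

(** Artin's argument for the independence of characters. *)
Lemma vertical_characters_independent (S : nat -> Prop) alpha p q :
  (forall n, S n -> (1 <= n)%nat) ->
  (forall m n, S m -> S n -> S (m * n)%nat) ->
  S p -> S q -> p <> 1%nat -> q <> 1%nat -> Nat.gcd p q = 1%nat ->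
  forall (l : list (C * R)),
  (forall n, S n -> lsum (fun x => Cmult (fst x) (npow n (Cconj (alpha, snd x)))) l = RtoC 0) ->
  forall F : R -> C, lsum (fun x => Cmult (fst x) (F (snd x))) l = RtoC 0.
Proof.
  intros Spos Smul Sp Sq Hp Hq G l.
  set (chi n b := npow n (Cconj (alpha, b))).
  change (forall n, S n -> lsum (fun x => Cmult (fst x) (npow n (Cconj (alpha, snd x)))) l = RtoC 0)
    with (forall n, S n -> lsum (fun x => Cmult (fst x) (chi n (snd x))) l = RtoC 0).
  (* Induction on the length, since the hypothesis is applied to the tail with altered coefficients.
     Frequencies may repeat in the list, so independence is expressed through an arbitrary [F]
     instead of vanishing coefficients. *)
  remember (length l) as N eqn:EN; revert l EN.
  induction N as [|N IH]; intros [|[c0 b0] l] EN Hl F; try discriminate; [reflexivity|].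
  injection EN; clear EN; intros EN.
  (* Multiplying by [chi b - chi b0] at [m] kills the head of the list. *)
  assert (Kill : forall m, S m -> forall F : R -> C,
    lsum (fun x => Cmult (fst x) (Cmult (Cminus (chi m (snd x)) (chi m b0)) (F (snd x)))) l = RtoC 0).
  { intros m Sm F'.
    pose proof (IH (map (fun x => (Cmult (fst x) (Cminus (chi m (snd x)) (chi m b0)), snd x)) l)) as K.
    rewrite length_map in K; specialize (K EN).
    assert (K' : forall n, S n -> lsum (fun x => Cmult (fst x) (chi n (snd x)))
        (map (fun x => (Cmult (fst x) (Cminus (chi m (snd x)) (chi m b0)), snd x)) l) = RtoC 0).
    { intros n Sn; rewrite lsum_map; simpl.
      pose proof (Hl _ (Smul _ _ Sm Sn)) as E1; pose proof (Hl _ Sn) as E2.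
      rewrite lsum_cons in E1, E2; simpl in E1, E2.
      transitivity (Cplus (lsum (fun x => Cmult (fst x) (chi (m * n)%nat (snd x))) l)
        (Cmult (Copp (chi m b0)) (lsum (fun x => Cmult (fst x) (chi n (snd x))) l))).
      - rewrite <- lsum_scal, <- lsum_plus; apply lsum_ext; intros x _.
        unfold chi; rewrite npow_mul by auto; ring.
      - replace (lsum (fun x => Cmult (fst x) (chi (m * n)%nat (snd x))) l)
          with (Copp (Cmult c0 (chi (m * n)%nat b0)))
          by (rewrite <- (Cplus_0_r (Copp _)), <- E1; ring).
        replace (lsum (fun x => Cmult (fst x) (chi n (snd x))) l)
          with (Copp (Cmult c0 (chi n b0)))
          by (rewrite <- (Cplus_0_r (Copp _)), <- E2; ring).
        unfold chi; rewrite npow_mul by auto; ring. }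
    specialize (K K' F'); rewrite lsum_map in K; simpl in K.
    rewrite <- K; apply lsum_ext; intros x _; ring. }
  (* A function vanishing at [b0] is written as [(chi p - chi p b0) G1 + (chi q - chi q b0) G2]:
     wherever both factors vanish, [b = b0]. [Kill] disposes of each summand. *)
  assert (Off : forall F : R -> C, F b0 = RtoC 0 ->
            lsum (fun x => Cmult (fst x) (F (snd x))) l = RtoC 0).
  { intros F' F0.
    set (pick m b := if excluded_middle_informative (chi m b = chi m b0) then RtoC 0
                     else Cdiv (F' b) (Cminus (chi m b) (chi m b0))).
    set (rest b := if excluded_middle_informative (chi p b = chi p b0) then pick q b else RtoC 0).
    rewrite <- (Cplus_0_r (RtoC 0)), <- (Kill p Sp (pick p)) at 1; rewrite <- (Kill q Sq rest).
    rewrite <- lsum_plus; apply lsum_ext; intros [c b] _; simpl.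
    assert (NZ : forall z w : C, z <> w -> Cminus z w <> RtoC 0).
    { intros z w Hzw E; apply Hzw; replace z with (Cplus (Cminus z w) w) by ring; rewrite E; ring. }
    unfold rest, pick.
    destruct (excluded_middle_informative (chi p b = chi p b0)) as [e|e].
    - destruct (excluded_middle_informative (chi q b = chi q b0)) as [e'|e'].
      + replace b with b0.
        * rewrite F0; ring.
        * symmetry; apply (npow_vertical_injective alpha p q); auto;
            [pose proof (Spos _ Sp) | pose proof (Spos _ Sq)]; lia.
      + field; auto.
    - field; auto. }
  pose proof (Hl p Sp) as E; rewrite lsum_cons in E; simpl in E; rewrite lsum_cons; simpl.
  pose proof (npow_neq0 p (Cconj (alpha, b0))) as NZ; fold (chi p b0) in NZ.
  (* The multiple of [chi p] that agrees with [F] at [b0] is subtracted; the relation at [n = p]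
     deals with that multiple, head included. *)
  pose proof (Off (fun b => Cminus (F b) (Cmult (Cdiv (F b0) (chi p b0)) (chi p b)))) as K.
  specialize (K ltac:(cbv beta; field; exact NZ)).
  transitivity (Cplus (Cmult (Cdiv (F b0) (chi p b0))
      (Cplus (Cmult c0 (chi p b0)) (lsum (fun x => Cmult (fst x) (chi p (snd x))) l)))
    (lsum (fun x => Cmult (fst x) (Cminus (F (snd x)) (Cmult (Cdiv (F b0) (chi p b0))
        (chi p (snd x))))) l)).
  - assert (E' : lsum (fun x => Cmult (fst x) (F (snd x))) l =
      Cplus (lsum (fun x => Cmult (Cdiv (F b0) (chi p b0)) (Cmult (fst x) (chi p (snd x)))) l)
        (lsum (fun x => Cmult (fst x) (Cminus (F (snd x)) (Cmult (Cdiv (F b0) (chi p b0))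
        (chi p (snd x))))) l)).
    { rewrite <- lsum_plus; apply lsum_ext; intros x _; ring. }
    rewrite E', lsum_scal; field; exact NZ.
  - rewrite E, K; ring.
Qed.

(** * Averages and dominated convergence *)

(** Irrationality of [sqrt 2] by infinite descent: [x] and [y] are both even, and their halves
    satisfy the same equation. *)
Lemma double_square_nat x y : (x * x = 2 * (y * y))%nat -> y = 0%nat.
Proof.
  revert y; induction x as [x IH] using lt_wf_ind; intros y E.
  destruct (Nat.Even_or_Odd x) as [[u ->]|[u ->]]; [|lia].
  destruct (Nat.Even_or_Odd y) as [[v ->]|[v ->]]; [|lia].
  destruct (Nat.eq_dec u 0) as [->|Hu]; [lia|].
  rewrite (IH u ltac:(lia) v ltac:(nia)); lia.
Qed.

(** Powers of [1 + sqrt 2] stay in [N + N sqrt 2]; carrying [0 < A] is what makes the next [B],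
    equal to [A + B], positive. *)
Lemma silver_pow k : exists A B : nat,
  (1 + sqrt 2) ^ k = INR A + INR B * sqrt 2 /\ (0 < k -> 0 < B)%nat /\ (0 < A)%nat.
Proof.
  induction k as [|k (A & B & E & HB & HA)].
  - exists 1%nat, 0%nat; simpl; split; [ring | split; lia].
  - exists (A + 2 * B)%nat, (A + B)%nat; split; [|split; lia].
    simpl pow; rewrite E, !plus_INR, mult_INR; simpl (INR 2).
    pose proof (sqrt_sqrt 2 ltac:(lra)) as S.
    transitivity (INR A + INR B * (sqrt 2 * sqrt 2) + (INR A + INR B) * sqrt 2); [ring|].
    rewrite S; ring.
Qed.

Lemma silver_pow_irrational k m n : (1 <= n)%nat ->
  INR m = (1 + sqrt 2) ^ k * INR n -> k = 0%nat.
Proof.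
  intros Hn E; destruct (silver_pow k) as (A & B & E' & HB & _); rewrite E' in E.
  destruct k as [|k]; [easy|]; exfalso; specialize (HB ltac:(lia)).
  pose proof (sqrt_sqrt 2 ltac:(lra)) as S; pose proof (sqrt_pos 2).
  pose proof (pos_INR B); pose proof (pos_INR n).
  (* The descent is applied to [(m - n A)^2 = 2 (n B)^2], where the subtraction is that of [nat] and
     must not be truncated. *)
  assert (L : (n * A <= m)%nat).
  { apply INR_le; rewrite E, mult_INR; assert (0 <= INR B * sqrt 2 * INR n); [|lra].
    repeat apply Rmult_le_pos; easy. }
  assert (Z : (n * B)%nat = 0%nat); [|nia].
  apply (double_square_nat (m - n * A)); apply INR_eq.
  rewrite !mult_INR, minus_INR, !mult_INR, E by easy; simpl (INR 2).
  replace (1 + 1) with (sqrt 2 * sqrt 2) by lra; ring.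
Qed.

(** Chosen so that [(m / n)^{i k step} <> 1] whenever [m <> n] and [k <> 0]:
    no non-trivial power of [1 + sqrt 2] is rational. *)
Definition step : R := PI / ln (1 + sqrt 2).

Lemma ln_silver_pos : 0 < ln (1 + sqrt 2).
Proof.
  rewrite <- ln_1; apply ln_increasing; [lra|]; pose proof (sqrt_lt_R0 2 ltac:(lra)); lra.
Qed.

Lemma step_pos : 0 < step.
Proof. apply Rdiv_lt_0_compat; [apply PI_RGT_0 | apply ln_silver_pos]. Qed.

Lemma log_eq_silver_pow m n k : (1 <= m)%nat -> (1 <= n)%nat ->
  ln (INR m) - ln (INR n) = INR k * ln (1 + sqrt 2) -> m = n.
Proof.
  intros Hm Hn E; pose proof (sqrt_pos 2).
  assert (Pm : 0 < INR m) by (apply lt_0_INR; lia).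
  assert (Pn : 0 < INR n) by (apply lt_0_INR; lia).
  assert (E' : INR m = (1 + sqrt 2) ^ k * INR n).
  { apply ln_inv; [easy | apply Rmult_lt_0_compat; [apply pow_lt; lra | easy]|].
    rewrite ln_mult, ln_pow; [lra | lra | apply pow_lt; lra | easy]. }
  pose proof (silver_pow_irrational k m n Hn E'); subst k.
  apply INR_eq; rewrite E'; simpl; ring.
Qed.

(** A zero of the sine makes [m / n] an integral power of [1 + sqrt 2]; a negative exponent is
    handled by exchanging [m] and [n]. With [PI] and not [2 PI] in [step], the imaginary part of
    [(m / n)^{i step}] alone separates [m] from [n]. *)
Lemma step_separates m n : (1 <= m)%nat -> (1 <= n)%nat ->
  sin (step * (ln (INR m) - ln (INR n))) = 0 -> m = n.
Proof.
  intros Hm Hn S; apply sin_eq_0_0 in S; destruct S as [j E].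
  pose proof ln_silver_pos as PL; pose proof PI_RGT_0 as PP.
  assert (E' : ln (INR m) - ln (INR n) = IZR j * ln (1 + sqrt 2)).
  { apply (Rmult_eq_reg_l step); [|pose proof step_pos; lra].
    rewrite E; unfold step; field; lra. }
  destruct (Z_le_gt_dec 0 j) as [Hj|Hj].
  - apply (log_eq_silver_pow m n (Z.to_nat j)); auto.
    rewrite (INR_IZR_INZ (Z.to_nat _)), Z2Nat.id by easy; exact E'.
  - symmetry; apply (log_eq_silver_pow n m (Z.to_nat (- j))); auto.
    rewrite (INR_IZR_INZ (Z.to_nat _)), Z2Nat.id, opp_IZR by lia; lra.
Qed.

(** This is [(m / n)^{i step}]: [m^{i step}] comes from the [m]-th coefficient of a kernel at height
    [step], and [n^{-i step}] from the coefficient that singles out [n]. *)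
Definition ratio (m n : nat) : C := Cmult (npow n (0, step)) (npow m (0, - step)).

Lemma Cmod_npow_imaginary n b : Cmod (npow n (0, b)) = 1.
Proof. rewrite Cmod_npow; simpl; rewrite Ropp_0, Rmult_0_l; apply exp_0. Qed.

Lemma Cmod_ratio m n : Cmod (ratio m n) = 1.
Proof. unfold ratio; rewrite Cmod_mult, !Cmod_npow_imaginary; ring. Qed.

Lemma ratio_diag n : ratio n n = RtoC 1.
Proof.
  unfold ratio; rewrite <- npow_add, <- (npow_0 n); f_equal.
  unfold Cplus, RtoC; simpl; f_equal; ring.
Qed.

Lemma ratio_neq_1 m n : (1 <= m)%nat -> (1 <= n)%nat -> m <> n -> ratio m n <> RtoC 1.
Proof.
  intros Hm Hn Hmn E; apply Hmn, step_separates; auto.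
  apply (f_equal Im) in E; unfold ratio, npow in E.
  cbn [Re Im Cmult RtoC fst snd] in E.
  replace (- step * ln (INR m)) with (- (step * ln (INR m))) in E by ring.
  rewrite Ropp_0, !Rmult_0_l, exp_0, cos_neg, sin_neg in E.
  rewrite Rmult_minus_distr_l, sin_minus; lra.
Qed.

(** The indices start beyond [L] so that the weights [1 / k] used to undo the
    factors [i k step] in [T_alpha] are all at most [1 / L]. *)
Definition average (L : nat) (z : C) : C :=
  Cmult (RtoC (/ INR L)) (lsum (fun k => Cpow z k) (seq (S L) L)).

Lemma average_1 L : (1 <= L)%nat -> average L (RtoC 1) = RtoC 1.
Proof.
  intros HL; unfold average.
  assert (E : forall s n, lsum (fun k => Cpow (RtoC 1) k) (seq s n) = RtoC (INR n)).
  { intros s n; revert s; induction n as [|n IH]; intros s; [reflexivity|].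
    simpl seq; rewrite lsum_cons, IH, <- RtoC_pow, pow1, S_INR, RtoC_plus; ring. }
  rewrite E, <- RtoC_mult; f_equal; field; apply not_0_INR; lia.
Qed.

Lemma geometric_lsum z s n :
  Cmult (Cminus z (RtoC 1)) (lsum (fun k => Cpow z k) (seq s n)) =
  Cminus (Cpow z (s + n)) (Cpow z s).
Proof.
  revert s; induction n as [|n IH]; intros s.
  - rewrite Nat.add_0_r; simpl seq; rewrite lsum_nil; ring.
  - simpl seq; rewrite lsum_cons, Cmult_plus_distr_l, IH, Nat.add_succ_r, Nat.add_succ_l.
    simpl Cpow; ring.
Qed.

Lemma Cmod_average_le_1 L z : (1 <= L)%nat -> Cmod z = 1 -> Cmod (average L z) <= 1.
Proof.
  intros HL Hz; assert (PL : 0 < INR L) by (apply lt_0_INR; lia).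
  unfold average; rewrite Cmod_mult, Cmod_R, Rabs_pos_eq
    by (left; now apply Rinv_0_lt_compat).
  apply Rmult_le_reg_l with (INR L); [easy|].
  rewrite <- Rmult_assoc, Rinv_r, Rmult_1_l by lra.
  replace (INR L) with (INR (length (seq (S L) L))) by now rewrite length_seq.
  apply Cmod_lsum_le_length; intros k _; rewrite Cmod_pow, Hz, pow1; lra.
Qed.

Lemma Cmod_average_le L z : (1 <= L)%nat -> Cmod z = 1 -> z <> RtoC 1 ->
  Cmod (average L z) <= 2 / Cmod (Cminus z (RtoC 1)) / INR L.
Proof.
  intros HL Hz Nz; assert (PL : 0 < INR L) by (apply lt_0_INR; lia).
  assert (P : 0 < Cmod (Cminus z (RtoC 1))).
  { apply Cmod_gt_0; intros E; apply Nz.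
    replace z with (Cplus (Cminus z (RtoC 1)) (RtoC 1)) by ring; rewrite E; ring. }
  unfold average; rewrite Cmod_mult, Cmod_R, Rabs_pos_eq
    by (left; now apply Rinv_0_lt_compat).
  unfold Rdiv; rewrite (Rmult_comm (/ INR L)); apply Rmult_le_compat_r;
    [left; now apply Rinv_0_lt_compat|].
  apply Rmult_le_reg_l with (Cmod (Cminus z (RtoC 1))); [easy|].
  rewrite <- Cmod_mult, geometric_lsum.
  replace (Cmod (z - 1) * (2 * / Cmod (z - 1))) with 2 by (field; lra).
  unfold Cminus; eapply Rle_trans; [apply Cmod_triangle|].
  rewrite Cmod_opp, !Cmod_pow, Hz, !pow1; lra.
Qed.

(** The geometric sum stays bounded by [2 / |ratio m n - 1|]. Thus [K] depends on [m], and it has no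
    bound uniform in [m]. *)
Lemma average_ratio_rate m n : (1 <= m)%nat -> (1 <= n)%nat ->
  exists K, 0 <= K /\ forall L, (1 <= L)%nat ->
    Cmod (Cminus (average L (ratio m n)) (RtoC (if Nat.eq_dec m n then 1 else 0))) <= K / INR L.
Proof.
  intros Hm Hn; destruct (Nat.eq_dec m n) as [->|D].
  - exists 0; split; [lra|]; intros L HL.
    rewrite ratio_diag, average_1 by easy.
    replace (Cminus (RtoC 1) (RtoC 1)) with (RtoC 0) by ring.
    rewrite Cmod_0; unfold Rdiv; lra.
  - exists (2 / Cmod (Cminus (ratio m n) (RtoC 1))).
    pose proof (ratio_neq_1 m n Hm Hn D) as Nz; split.
    + apply Rdiv_le_0_compat; [lra|]; apply Cmod_gt_0; intros E; apply Nz.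
      replace (ratio m n) with (Cplus (Cminus (ratio m n) (RtoC 1)) (RtoC 1)) by ring.
      rewrite E; ring.
    + intros L HL; replace (Cminus _ (RtoC 0)) with (average L (ratio m n)) by ring.
      apply Cmod_average_le; auto using Cmod_ratio.
Qed.

(** * Dominated convergence for series *)

Lemma Series_tail_small (B : nat -> R) eps : ex_series B -> 0 < eps ->
  exists M, Series (fun k => B (M + k)%nat) < eps.
Proof.
  intros HB He; pose proof (Series_correct _ HB) as L; apply is_series_Reals in L.
  (* The partial sum of index [M] has [M + 1] terms, so the tail starts at [S M]. *)
  destruct (L eps He) as [M HM]; exists (S M).
  specialize (HM M ltac:(lia)); unfold Rdist in HM.
  rewrite (Series_incr_n B (S M)) in HM by (lia || easy); simpl pred in HM.
  apply Rabs_def2 in HM; lra.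
Qed.

(** The first [M] terms are each [O(1 / L)] and their constants add up; the others are bounded by
    the tail of [B]. Pointwise convergence is assumed as a rate so that finitely many terms combine
    without choosing thresholds. *)
Lemma Tannery_rate (M : nat) : forall (F : nat -> nat -> R) (B : nat -> R),
  ex_series B -> (forall L m, (1 <= L)%nat -> 0 <= F L m <= B m) ->
  (forall m, exists K, forall L, (1 <= L)%nat -> F L m <= K / INR L) ->
  exists K, forall L, (1 <= L)%nat ->
    Series (F L) <= K / INR L + Series (fun k => B (M + k)%nat).
Proof.
  induction M as [|M IH]; intros F B HB HF HK.
  - exists 0; intros L HL; unfold Rdiv; rewrite Rmult_0_l, Rplus_0_l.
    apply Series_le; auto.
  - destruct (HK 0%nat) as [K0 HK0].
    destruct (IH (fun L m => F L (S m)) (fun m => B (S m))) as [K1 HK1]; auto.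
    { now apply -> (@ex_series_incr_1 R_AbsRing R_NormedModule B). }
    exists (K0 + K1); intros L HL; rewrite Series_incr_1.
    + specialize (HK0 L HL); specialize (HK1 L HL).
      change (fun k => B (S M + k)%nat) with (fun k => B (S (M + k))).
      replace ((K0 + K1) / INR L) with (K0 / INR L + K1 / INR L)
        by (unfold Rdiv; ring); lra.
    + apply (@ex_series_le R_AbsRing R_CompleteNormedModule) with B; [|easy].
      intros m; change (Rabs (F L m) <= B m); rewrite Rabs_pos_eq; apply HF, HL.
Qed.

Lemma div_INR_small K eps : 0 < eps ->
  exists L0, (1 <= L0)%nat /\ forall L, (L0 <= L)%nat -> K / INR L < eps.
Proof.
  intros He; pose proof (Rabs_pos K).
  destruct (archimed_cor1 (eps / (Rabs K + 1))) as [N [HN PN]]; [apply Rdiv_lt_0_compat; lra|].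
  exists N; split; [lia|]; intros L HL.
  assert (PL : 0 < INR L) by (apply lt_0_INR; lia).
  apply Rle_lt_trans with ((Rabs K + 1) * / INR N).
  - unfold Rdiv; apply Rle_trans with ((Rabs K + 1) * / INR L).
    + apply Rmult_le_compat_r; [left; now apply Rinv_0_lt_compat|]; pose proof (Rle_abs K); lra.
    + apply Rmult_le_compat_l; [lra|]; apply Rinv_le_contravar; [now apply lt_0_INR | now apply le_INR].
  - replace eps with ((Rabs K + 1) * (eps / (Rabs K + 1))) by (field; lra).
    apply Rmult_lt_compat_l; lra.
Qed.

Lemma Tannery (F : nat -> nat -> R) (B : nat -> R) eps :
  ex_series B -> (forall L m, (1 <= L)%nat -> 0 <= F L m <= B m) ->
  (forall m, exists K, forall L, (1 <= L)%nat -> F L m <= K / INR L) ->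
  0 < eps -> exists L0, (1 <= L0)%nat /\ forall L, (L0 <= L)%nat -> Series (F L) < eps.
Proof.
  intros HB HF HK He.
  destruct (Series_tail_small B (eps / 2) HB) as [M HM]; [lra|].
  destruct (Tannery_rate M F B HB HF HK) as [K HK'].
  destruct (div_INR_small K (eps / 2)) as [L0 [P0 HL0]]; [lra|].
  exists L0; split; [easy|]; intros L HL.
  specialize (HK' L ltac:(lia)); specialize (HL0 L HL); lra.
Qed.

(** * Approximating the graph *)

Definition vertical (alpha : R) (l : list (C * R)) : list (C * C) :=
  map (fun p => (fst p, (alpha, snd p))) l.

(** [T_alpha] maps its domain into itself, so it can act on lists, and the norm formulas for
    combinations apply to its values too. *)
Definition Tlist (l : list (C * R)) : list (C * R) :=
  map (fun p => (Cmult (fst p) (Cmult Ci (RtoC (snd p))), snd p)) l.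

Lemma kcomb_gcomb rho a alpha l : kcomb rho a alpha l = gcomb a (vertical alpha l).
Proof.
  apply functional_extensionality; intros s; unfold gcomb, vertical; rewrite lsum_map; reflexivity.
Qed.

Lemma Tcomb_kcomb rho a alpha l : Tcomb rho a alpha l = kcomb rho a alpha (Tlist l).
Proof.
  apply functional_extensionality; intros s.
  change (lsum (fun p : C * R => Cmult (fst p) (Cmult (Cmult Ci (RtoC (snd p)))
            (kappa a (proj1_sig s) (alpha, snd p)))) l =
          lsum (fun p => Cmult (fst p) (kappa a (proj1_sig s) (alpha, snd p))) (Tlist l)).
  unfold Tlist; rewrite lsum_map; apply lsum_ext; intros p _; simpl; ring.
Qed.

Lemma in_half_plane_vertical rho alpha l : rho < alpha -> in_half_plane rho (vertical alpha l).
Proof. intros Ha p Hp; apply in_map_iff in Hp; destruct Hp as [q [<- _]]; exact Ha. Qed.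

Lemma symbol_vertical alpha l n :
  symbol (vertical alpha l) n = lsum (fun p => Cmult (fst p) (npow n (Cconj (alpha, snd p)))) l.
Proof. unfold symbol, vertical; now rewrite lsum_map. Qed.

Lemma npow_imaginary_pow n x k : npow n (0, x * INR k) = Cpow (npow n (0, x)) k.
Proof.
  induction k as [|k IH]; [simpl; rewrite Rmult_0_r; apply npow_0|].
  change (Cpow (npow n (0, x)) (S k)) with (Cmult (npow n (0, x)) (Cpow (npow n (0, x)) k)).
  rewrite <- IH, <- npow_add; f_equal.
  rewrite S_INR; unfold Cplus; simpl; f_equal; ring.
Qed.

Lemma npow_vertical_step m alpha k :
  npow m (Cconj (alpha, step * INR k)) =
  Cmult (npow m (RtoC alpha)) (Cpow (npow m (0, - step)) k).
Proof.
  rewrite <- npow_imaginary_pow, <- npow_add; f_equal.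
  unfold Cconj, Cplus, RtoC; simpl; f_equal; ring.
Qed.

(** The factor that turns the [n]-th coefficient [a_n n^{-alpha}] of [kappa_alpha] into the one of
    [kappa_t], which is [a_n n^{-conj t}]. *)
Definition amplitude (alpha : R) (t : C) (n : nat) : C :=
  npow n (Cminus (Cconj t) (RtoC alpha)).

(** [T_alpha] maps this combination, of norm [O(1 / L)], to one that tends as
    [L -> oo] to the partial sum of the Dirichlet series of [kappa_t] over [n <= N]. *)
Definition approximant (alpha : R) (t : C) (N L : nat) : list (C * R) :=
  flat_map (fun n => map (fun k =>
    (Cdiv (Cmult (amplitude alpha t n) (Cpow (npow n (0, step)) k))
          (Cmult (Cmult Ci (RtoC (step * INR k))) (RtoC (INR L))),
     step * INR k)) (seq (S L) L)) (seq 1 N).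

Definition amplitude_sum (alpha : R) (t : C) (N : nat) : R :=
  fold_right (fun n acc => Cmod (amplitude alpha t n) + acc) 0 (seq 1 N).

Lemma amplitude_sum_ge_0 alpha t N : 0 <= amplitude_sum alpha t N.
Proof.
  unfold amplitude_sum; induction (seq 1 N) as [|n l IH]; simpl; [lra|].
  pose proof (Cmod_ge_0 (amplitude alpha t n)); lra.
Qed.

Lemma fold_right_scal_r {A : Type} (f : A -> R) c l :
  fold_right (fun x acc => f x * c + acc) 0 l = fold_right (fun x acc => f x + acc) 0 l * c.
Proof. induction l as [|x l IH]; simpl; [ring | rewrite IH; ring]. Qed.

Lemma symbol_T_approximant alpha t N L m : (1 <= L)%nat ->
  symbol (vertical alpha (Tlist (approximant alpha t N L))) m =
  Cmult (npow m (RtoC alpha))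
    (lsum (fun n => Cmult (amplitude alpha t n) (average L (ratio m n))) (seq 1 N)).
Proof.
  intros HL; rewrite symbol_vertical; unfold Tlist; rewrite lsum_map.
  unfold approximant; rewrite lsum_flat_map, <- lsum_scal; apply lsum_ext; intros n _.
  rewrite lsum_map; unfold average; rewrite <- !lsum_scal; apply lsum_ext; intros k Hk.
  apply in_seq in Hk; cbn [fst snd].
  rewrite npow_vertical_step; unfold ratio; rewrite Cpow_mult_l.
  rewrite RtoC_inv by (apply not_0_INR; lia); field; repeat split.
  - intros E; apply (f_equal Re) in E; simpl in E; apply not_0_INR in E; [easy|lia].
  - intros E; apply (f_equal Re) in E; simpl in E; pose proof step_pos.
    apply Rmult_integral in E; destruct E as [E|E]; [lra|]; apply not_0_INR in E; [easy|lia].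
  - intros E; apply (f_equal Im) in E; simpl in E; lra.
Qed.

Lemma Cmod_symbol_approximant alpha t N L m : (1 <= L)%nat ->
  Cmod (symbol (vertical alpha (approximant alpha t N L)) m) <=
  amplitude_sum alpha t N / (step * INR L) * exp (- alpha * ln (INR m)).
Proof.
  intros HL; rewrite symbol_vertical; unfold approximant; rewrite lsum_flat_map.
  pose proof step_pos as Ps; assert (PL : 0 < INR L) by (apply lt_0_INR; lia).
  set (E := exp (- alpha * ln (INR m))).
  assert (PE : 0 < E) by apply exp_pos.
  replace (amplitude_sum alpha t N / (step * INR L) * E)
    with (amplitude_sum alpha t N * (E / (step * INR L))) by (field; lra).
  unfold amplitude_sum; rewrite <- fold_right_scal_r; apply Cmod_lsum_le; intros n _.
  rewrite lsum_map; cbn [fst snd].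
  (* There are [L] summands. One factor [1 / L] of each comes from the averaging, the other from
     dividing by [step * k] with [k > L]; the number of summands cancels one of them. *)
  replace (Cmod (amplitude alpha t n) * (E / (step * INR L)))
    with (INR (length (seq (S L) L)) *
            (Cmod (amplitude alpha t n) * E / (step * INR L * INR L)))
    by (rewrite length_seq; field; lra).
  apply Cmod_lsum_le_length; intros k Hk; apply in_seq in Hk.
  assert (Pk : INR L <= INR k) by (apply le_INR; lia).
  rewrite npow_vertical_step, Cmod_mult, Cmod_div.
  - rewrite !Cmod_mult, !Cmod_pow, !Cmod_npow_imaginary, Cmod_npow, !Cmod_R, Cmod_Ci, !pow1.
    cbn [Re RtoC fst]; fold E.
    rewrite (Rabs_pos_eq (step * INR k)), (Rabs_pos_eq (INR L))
      by (first [lra | apply Rmult_le_pos; lra]).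
    rewrite !Rmult_1_r, Rmult_1_l; unfold Rdiv.
    rewrite Rmult_assoc, (Rmult_comm (/ _)), <- Rmult_assoc.
    apply Rmult_le_compat_l; [apply Rmult_le_pos; [apply Cmod_ge_0|lra]|].
    apply Rinv_le_contravar; [repeat (apply Rmult_lt_0_compat; [|lra]); lra|].
    apply Rmult_le_compat_r; [lra|]; apply Rmult_le_compat_l; lra.
  - apply Cmod_gt_0; rewrite !Cmod_mult, Cmod_Ci, !Cmod_R, Rmult_1_l.
    rewrite !Rabs_pos_eq by (first [lra | apply Rmult_le_pos; lra]).
    repeat (apply Rmult_lt_0_compat; [|lra]); lra.
Qed.

Lemma Cmod_sqr_plus_le (z w : C) : Cmod (Cplus z w) ^ 2 <= 2 * Cmod z ^ 2 + 2 * Cmod w ^ 2.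
Proof.
  apply Rle_trans with ((Cmod z + Cmod w) ^ 2).
  - apply pow_incr; split; [apply Cmod_ge_0 | apply Cmod_triangle].
  - pose proof (pow2_ge_0 (Cmod z - Cmod w)); lra.
Qed.

Lemma lsum_indicator (f : nat -> C) m N : (1 <= m)%nat ->
  lsum (fun n => Cmult (f n) (RtoC (if Nat.eq_dec m n then 1 else 0))) (seq 1 N) =
  if le_dec m N then f m else RtoC 0.
Proof.
  intros Hm; induction N as [|N IH].
  - destruct (le_dec m 0); [lia | reflexivity].
  - rewrite seq_S, lsum_app, IH, lsum_cons, lsum_nil; simpl Nat.add.
    destruct (Nat.eq_dec m (S N)) as [E|D], (le_dec m N), (le_dec m (S N));
      try lia; try rewrite E; ring.
Qed.

Section Approximation.

Context {rho : R} {a : nat -> R}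
        (Ha : forall n, (1 <= n)%nat -> 0 <= a n) (Hconv : kappa_conv rho a)
        {H : Fun rho -> Prop} {ip : Fun rho -> Fun rho -> C} (HK : is_RKHS rho a H ip)
        (alpha : R) (Halpha : rho < alpha).

Lemma weight_eq sigma k (s : C) : Re s = sigma ->
  weight a sigma k = a (S k) * Cmod (npow (S k) s) ^ 2.
Proof.
  intros <-; unfold weight; rewrite Cmod_npow; f_equal.
  rewrite <- Rsqr_pow2; unfold Rsqr; rewrite <- exp_plus; f_equal; ring.
Qed.

Lemma H_kcomb l : H (kcomb rho a alpha l).
Proof. rewrite kcomb_gcomb; apply (H_gcomb HK); now apply in_half_plane_vertical. Qed.

Lemma hnorm_approximant_le t N L : (1 <= L)%nat ->
  hnorm ip (kcomb rho a alpha (approximant alpha t N L)) ^ 2 <=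
  (amplitude_sum alpha t N / (step * INR L)) ^ 2 * Series (weight a alpha).
Proof.
  intros HL; rewrite kcomb_gcomb.
  destruct (hnorm_gcomb Ha Hconv HK (vertical alpha (approximant alpha t N L)))
    as [_ ->]; [now apply in_half_plane_vertical|].
  rewrite <- Series_scal_l; apply Series_le.
  - intros k; split; [apply Rmult_le_pos; [apply Ha; lia | apply pow2_ge_0]|].
    rewrite (weight_eq alpha k (RtoC alpha)) by reflexivity.
    rewrite (Rmult_comm _ (a (S k) * _)), Rmult_assoc.
    apply Rmult_le_compat_l; [apply Ha; lia|].
    rewrite <- Rpow_mult_distr; apply pow_incr; split; [apply Cmod_ge_0|].
    rewrite Rmult_comm, Cmod_npow; now apply Cmod_symbol_approximant.
  - apply (@ex_series_scal R_AbsRing R_NormedModule), (ex_series_weight Hconv), Halpha.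
Qed.

(** [kappa_t] enters as one more point with coefficient [-1], so the distance is the norm of a
    single combination. As [t] may lie off the line of abscissa [alpha], [gcomb] allows arbitrary
    points. *)
Lemma T_approximant_series (t : Hrho rho) N L : (1 <= L)%nat ->
  let x k := Cminus (symbol (vertical alpha (Tlist (approximant alpha (proj1_sig t) N L))) (S k))
                    (npow (S k) (Cconj (proj1_sig t))) in
  ex_series (fun k => a (S k) * Cmod (x k) ^ 2) /\
  hnorm ip (fsub (Tcomb rho a alpha (approximant alpha (proj1_sig t) N L))
                 (kfun a (proj1_sig t))) ^ 2 = Series (fun k => a (S k) * Cmod (x k) ^ 2).
Proof.
  intros HL x; destruct t as [t Ht]; cbn [proj1_sig] in x |- *.
  set (l := vertical alpha (Tlist (approximant alpha t N L))) in *.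
  assert (Hl : in_half_plane rho ((Copp (RtoC 1), t) :: l)).
  { intros p [<-|Hp]; [exact Ht | exact (in_half_plane_vertical _ _ _ Halpha _ Hp)]. }
  destruct (hnorm_gcomb Ha Hconv HK _ Hl) as [S1 E1].
  assert (E : forall k, a (S k) * Cmod (symbol ((Copp (RtoC 1), t) :: l) (S k)) ^ 2 =
                        a (S k) * Cmod (x k) ^ 2).
  { intros k; do 3 f_equal; unfold symbol, x; rewrite lsum_cons; simpl fst; simpl snd.
    fold (symbol l (S k)); ring. }
  split; [apply (ex_series_ext _ _ E), S1|].
  rewrite <- (Series_ext _ _ E), <- E1; do 2 f_equal.
  rewrite Tcomb_kcomb, kcomb_gcomb, gcomb_cons; fold l.
  apply functional_extensionality; intros s; unfold fsub, fadd, fscal; simpl; ring.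
Qed.

(** Separates the averaging error, which vanishes as [L -> oo] for fixed [N], from the truncation
    error, which lives on [m > N] and does not involve [L]. *)
Lemma T_approximant_symbol_error t N L m : (1 <= L)%nat -> (1 <= m)%nat ->
  Cminus (symbol (vertical alpha (Tlist (approximant alpha t N L))) m) (npow m (Cconj t)) =
  Cplus (Cmult (npow m (RtoC alpha))
          (lsum (fun n => Cmult (amplitude alpha t n)
                   (Cminus (average L (ratio m n)) (RtoC (if Nat.eq_dec m n then 1 else 0))))
                (seq 1 N)))
        (if le_dec m N then RtoC 0 else Copp (npow m (Cconj t))).
Proof.
  intros HL Hm; rewrite symbol_T_approximant by easy.
  pose proof (lsum_indicator (amplitude alpha t) m N Hm) as E.
  transitivity (Cplus (Cmult (npow m (RtoC alpha))
      (Cminus (lsum (fun n => Cmult (amplitude alpha t n) (average L (ratio m n))) (seq 1 N))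
              (lsum (fun n => Cmult (amplitude alpha t n)
                      (RtoC (if Nat.eq_dec m n then 1 else 0))) (seq 1 N))))
    (if le_dec m N then RtoC 0 else Copp (npow m (Cconj t)))).
  - rewrite E; destruct (le_dec m N); [|ring].
    replace (npow m (Cconj t)) with (Cmult (npow m (RtoC alpha)) (amplitude alpha t m)); [ring|].
    unfold amplitude; rewrite <- npow_add; f_equal; ring.
  - f_equal; f_equal.
    transitivity (Cplus (lsum (fun n => Cmult (amplitude alpha t n) (average L (ratio m n))) (seq 1 N))
      (lsum (fun n => Cmult (Copp (RtoC 1)) (Cmult (amplitude alpha t n)
               (RtoC (if Nat.eq_dec m n then 1 else 0)))) (seq 1 N))).
    + rewrite lsum_scal; ring.
    + rewrite <- lsum_plus; apply lsum_ext; intros n _; ring.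
Qed.

Lemma average_error_series_small t N eps : 0 < eps ->
  let F L k := a (S k) * Cmod (Cmult (npow (S k) (RtoC alpha))
          (lsum (fun n => Cmult (amplitude alpha t n)
                   (Cminus (average L (ratio (S k) n))
                           (RtoC (if Nat.eq_dec (S k) n then 1 else 0))))
                (seq 1 N))) ^ 2 in
  exists L0, (1 <= L0)%nat /\
    forall L, (L0 <= L)%nat -> ex_series (F L) /\ Series (F L) < eps.
Proof.
  intros He F; pose proof (amplitude_sum_ge_0 alpha t N) as PA.
  (* The 2 bounds an average of modulus at most 1 minus an indicator. *)
  set (B k := weight a alpha k * (amplitude_sum alpha t N * 2) ^ 2).
  assert (HB : ex_series B).
  { apply (ex_series_scal_r ((amplitude_sum alpha t N * 2) ^ 2)), (ex_series_weight Hconv), Halpha. }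
  assert (HF : forall L m, (1 <= L)%nat -> 0 <= F L m <= B m).
  { intros L m HL; unfold F, B; split; [apply Rmult_le_pos; [apply Ha; lia | apply pow2_ge_0]|].
    rewrite (weight_eq alpha m (RtoC alpha)), Rmult_assoc by reflexivity.
    apply Rmult_le_compat_l; [apply Ha; lia|].
    rewrite Cmod_mult, !Rpow_mult_distr; apply Rmult_le_compat_l; [apply pow2_ge_0|].
    rewrite <- Rpow_mult_distr; apply pow_incr; split; [apply Cmod_ge_0|].
    unfold amplitude_sum; rewrite <- fold_right_scal_r; apply Cmod_lsum_le; intros n _.
    rewrite Cmod_mult; apply Rmult_le_compat_l; [apply Cmod_ge_0|].
    unfold Cminus; eapply Rle_trans; [apply Cmod_triangle|]; rewrite Cmod_opp, Cmod_R.
    pose proof (Cmod_average_le_1 L _ HL (Cmod_ratio (S m) n)).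
    destruct (Nat.eq_dec (S m) n); rewrite ?Rabs_R1, ?Rabs_R0; lra. }
  destruct (Tannery F B eps HB HF) as [L0 [P0 HL0]]; [|easy|].
  - intros m.
    assert (HKs : exists K, 0 <= K /\ forall L, (1 <= L)%nat ->
      Cmod (lsum (fun n => Cmult (amplitude alpha t n)
                   (Cminus (average L (ratio (S m) n))
                           (RtoC (if Nat.eq_dec (S m) n then 1 else 0))))
                (seq 1 N)) <= K / INR L).
    { clear HF HB B F; assert (Hseq : forall n, In n (seq 1 N) -> (1 <= n)%nat)
        by (intros n Hn; apply in_seq in Hn; lia).
      induction (seq 1 N) as [|n l IH].
      - exists 0; split; [lra|]; intros L HL; rewrite lsum_nil, Cmod_0; unfold Rdiv; lra.
      - destruct IH as [K1 [P1 HK1]]; [intros; apply Hseq; now right|].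
        destruct (average_ratio_rate (S m) n) as [K2 [P2 HK2]];
          [lia | apply Hseq; now left|].
        pose proof (Cmod_ge_0 (amplitude alpha t n)) as PM.
        exists (Cmod (amplitude alpha t n) * K2 + K1); split.
        + apply Rplus_le_le_0_compat; [apply Rmult_le_pos|]; easy.
        + intros L HL; rewrite lsum_cons; eapply Rle_trans; [apply Cmod_triangle|].
          rewrite Cmod_mult; unfold Rdiv; rewrite Rmult_plus_distr_r, Rmult_assoc.
          apply Rplus_le_compat; [apply Rmult_le_compat_l; [easy | now apply HK2] | now apply HK1]. }
    destruct HKs as [K [PK HKs]].
    exists (weight a alpha m * K ^ 2); intros L HL; unfold F.
    assert (PL : 1 <= INR L) by now apply (le_INR 1).
    rewrite (weight_eq alpha m (RtoC alpha)) by reflexivity.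
    rewrite Cmod_mult, Rpow_mult_distr, <- Rmult_assoc; unfold Rdiv at 1.
    rewrite (Rmult_assoc (a (S m) * _)).
    apply Rmult_le_compat_l; [apply Rmult_le_pos; [apply Ha; lia | apply pow2_ge_0]|].
    apply Rle_trans with ((K / INR L) ^ 2).
    + apply pow_incr; split; [apply Cmod_ge_0 | now apply HKs].
    + assert (0 < / INR L <= 1).
      { split; [apply Rinv_0_lt_compat; lra|].
        rewrite <- Rinv_1; apply Rinv_le_contravar; lra. }
      unfold Rdiv; rewrite Rpow_mult_distr; apply Rmult_le_compat_l; [apply pow2_ge_0|]; nra.
  - exists L0; split; [easy|]; intros L HL; split; [|now apply HL0].
    apply (@ex_series_le R_AbsRing R_CompleteNormedModule) with B; [|easy].
    intros k; change (Rabs (F L k) <= B k); rewrite Rabs_pos_eq; apply HF; lia.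
Qed.

Lemma T_approximant_tends (t : Hrho rho) eps : 0 < eps ->
  exists N L0, (1 <= L0)%nat /\ forall L, (L0 <= L)%nat ->
    hnorm ip (fsub (Tcomb rho a alpha (approximant alpha (proj1_sig t) N L))
                   (kfun a (proj1_sig t))) < eps.
Proof.
  (* The squared error is at most twice the averaging part plus twice the truncation part, each kept
     below [eps^2 / 4]. *)
  intros He; assert (He2 : 0 < eps ^ 2 / 4) by (pose proof (pow_lt _ 2 He); lra).
  pose proof (ex_series_weight Hconv _ (proj2_sig t)) as SW.
  destruct (Series_tail_small _ _ SW He2) as [N HN].
  destruct (average_error_series_small (proj1_sig t) N _ He2) as [L0 [P0 HL0]].
  exists N, L0; split; [easy|]; intros L HL.
  destruct (HL0 L HL) as [SF HF]; clear HL0.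
  destruct (T_approximant_series t N L ltac:(lia)) as [SX EX].
  set (F k := a (S k) * _ ^ 2) in SF, HF.
  set (G k := if le_dec (S k) N then 0 else weight a (Re (proj1_sig t)) k).
  assert (SG : ex_series G).
  { apply (@ex_series_le R_AbsRing R_CompleteNormedModule) with (2 := SW).
    intros k; change (Rabs (G k) <= weight a (Re (proj1_sig t)) k); unfold G.
    pose proof (weight_ge_0 Ha (Re (proj1_sig t)) k).
    destruct (le_dec (S k) N); rewrite Rabs_pos_eq; lra. }
  assert (EG : Series G = Series (fun k => weight a (Re (proj1_sig t)) (N + k)%nat)).
  { rewrite (Series_incr_n_aux G N).
    - apply Series_ext; intros k; unfold G; destruct (le_dec (S (N + k)) N); [lia|reflexivity].
    - intros k Hk; unfold G; destruct (le_dec (S k) N); [reflexivity|lia]. }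
  assert (Le : Series (fun k => a (S k) * Cmod (Cminus
       (symbol (vertical alpha (Tlist (approximant alpha (proj1_sig t) N L))) (S k))
       (npow (S k) (Cconj (proj1_sig t)))) ^ 2) <= 2 * Series F + 2 * Series G).
  { rewrite <- !Series_scal_l, <- Series_plus
      by (apply (@ex_series_scal R_AbsRing R_NormedModule); easy).
    apply Series_le.
    - intros k; split; [apply Rmult_le_pos; [apply Ha; lia | apply pow2_ge_0]|].
      rewrite T_approximant_symbol_error by lia.
      unfold F, G.
      replace (if le_dec (S k) N then 0 else weight a (Re (proj1_sig t)) k)
        with (a (S k) * Cmod (if le_dec (S k) N then RtoC 0
                else Copp (npow (S k) (Cconj (proj1_sig t)))) ^ 2).
      + rewrite <- !Rmult_assoc, !(Rmult_comm 2), !Rmult_assoc, <- Rmult_plus_distr_l.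
        apply Rmult_le_compat_l; [apply Ha; lia | apply Cmod_sqr_plus_le].
      + destruct (le_dec (S k) N); [rewrite Cmod_0; ring|].
        rewrite Cmod_opp, npow_conj, Cmod_conj; symmetry; now apply weight_eq.
    - apply (@ex_series_plus R_AbsRing R_NormedModule);
        apply (@ex_series_scal R_AbsRing R_NormedModule); easy. }
  rewrite <- EX in Le.
  apply Rnot_le_lt; intros C.
  assert (eps ^ 2 <= hnorm ip (fsub (Tcomb rho a alpha (approximant alpha (proj1_sig t) N L))
                                    (kfun a (proj1_sig t))) ^ 2) by (apply pow_incr; lra).
  lra.
Qed.

(** Puts every [(0, kappa_t)] in the closure of the graph of [T_alpha]. *)
Lemma graph_approximation (t : Hrho rho) eps : 0 < eps ->
  exists l, hnorm ip (kcomb rho a alpha l) < eps /\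
            hnorm ip (fsub (Tcomb rho a alpha l) (kfun a (proj1_sig t))) < eps.
Proof.
  intros He; destruct (T_approximant_tends t eps He) as [N [L0 [P0 HL0]]].
  set (A := amplitude_sum alpha (proj1_sig t) N).
  destruct (div_INR_small ((A / step) ^ 2 * Series (weight a alpha)) (eps ^ 2))
    as [L1 [P1 HL1]]; [now apply pow_lt|].
  set (L := (L0 + L1)%nat).
  exists (approximant alpha (proj1_sig t) N L); split; [|apply HL0; lia].
  specialize (HL1 L ltac:(lia)).
  pose proof (hnorm_approximant_le (proj1_sig t) N L ltac:(lia)) as B; fold A in B.
  assert (PL : 1 <= INR L) by (apply (le_INR 1); lia).
  assert (PW : 0 <= Series (weight a alpha)).
  { replace 0 with (Series (fun _ : nat => 0 * 0)) by (rewrite Series_scal_l; ring).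
    apply Series_le; [|now apply (ex_series_weight Hconv)].
    intros k; pose proof (weight_ge_0 Ha alpha k); lra. }
  pose proof step_pos as Ps.
  assert (Q : 0 < / INR L <= 1).
  { split; [apply Rinv_0_lt_compat; lra|].
    rewrite <- Rinv_1; apply Rinv_le_contravar; lra. }
  replace ((A / (step * INR L)) ^ 2 * Series (weight a alpha))
    with ((A / step) ^ 2 * Series (weight a alpha) * (/ INR L) ^ 2) in B by (field; lra).
  unfold Rdiv at 1 in HL1.
  (* The squared norm is [O(1 / L^2)]; it is weakened to the [O(1 / L)] that [div_INR_small] makes
     small. *)
  assert (B' : (A / step) ^ 2 * Series (weight a alpha) * (/ INR L) ^ 2 <=
               (A / step) ^ 2 * Series (weight a alpha) * / INR L).
  { apply Rmult_le_compat_l; [apply Rmult_le_pos; [apply pow2_ge_0 | easy] | nra]. }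
  apply Rnot_le_lt; intros C.
  assert (eps ^ 2 <= hnorm ip (kcomb rho a alpha (approximant alpha (proj1_sig t) N L)) ^ 2)
    by (apply pow_incr; lra).
  unfold Rdiv in *; lra.
Qed.

End Approximation.

(** * The operator *)

Lemma Series_zero_terms (u : nat -> R) :
  ex_series u -> (forall k, 0 <= u k) -> Series u = 0 -> forall k, u k = 0.
Proof.
  intros Su Pu E k; pose proof (Series_correct _ Su) as L; apply is_series_Reals in L.
  rewrite E in L; pose proof (sum_incr u k 0 L Pu) as B.
  pose proof (Pu k); apply Rle_antisym; [|easy].
  destruct k as [|k]; [exact B|].
  pose proof (cond_pos_sum u k Pu); rewrite tech5 in B; lra.
Qed.

Lemma kcomb_lsum rho a alpha l (s : Hrho rho) :
  kcomb rho a alpha l s =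
  lsum (fun p => Cmult (fst p) (kappa a (proj1_sig s) (alpha, snd p))) l.
Proof. reflexivity. Qed.

Lemma kcomb_app rho a alpha l l' :
  kcomb rho a alpha (l ++ l') = fadd (kcomb rho a alpha l) (kcomb rho a alpha l').
Proof.
  apply functional_extensionality; intros s; unfold fadd; rewrite !kcomb_lsum; apply lsum_app.
Qed.

Definition scale_list (c : C) (l : list (C * R)) : list (C * R) :=
  map (fun p => (Cmult c (fst p), snd p)) l.

Lemma kcomb_scale rho a alpha c l :
  kcomb rho a alpha (scale_list c l) = fscal c (kcomb rho a alpha l).
Proof.
  apply functional_extensionality; intros s; unfold fscal, scale_list.
  rewrite !kcomb_lsum, lsum_map, <- lsum_scal; apply lsum_ext; intros p _; simpl; ring.
Qed.

Lemma kcomb_sub rho a alpha l l' :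
  fsub (kcomb rho a alpha l) (kcomb rho a alpha l') =
  kcomb rho a alpha (l ++ scale_list (Copp (RtoC 1)) l').
Proof. now rewrite fsub_fadd, kcomb_app, kcomb_scale. Qed.

Lemma Tlist_app l l' : Tlist (l ++ l') = Tlist l ++ Tlist l'.
Proof. apply map_app. Qed.

Lemma kcomb_Tlist_scale rho a alpha c l :
  kcomb rho a alpha (Tlist (scale_list c l)) = fscal c (kcomb rho a alpha (Tlist l)).
Proof.
  rewrite <- kcomb_scale; f_equal; unfold Tlist, scale_list; rewrite !map_map.
  apply map_ext; intros p; simpl; f_equal; ring.
Qed.

(** * Vertical translations *)

Definition shift_point {rho : R} (c : R) (s : Hrho rho) : Hrho rho :=
  exist _ (Re (proj1_sig s), Im (proj1_sig s) - c) (proj2_sig s).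

Definition translate {rho : R} (c : R) (f : Fun rho) : Fun rho :=
  fun s => f (shift_point c s).

Definition shift_list (c : R) (l : list (C * R)) : list (C * R) :=
  map (fun p => (fst p, snd p + c)) l.

Lemma translate_translate {rho : R} c (f : Fun rho) : translate c (translate (- c) f) = f.
Proof.
  apply functional_extensionality; intros [[x y] Hs]; unfold translate; f_equal.
  apply subset_eq_compat; simpl; f_equal; ring.
Qed.

Lemma kappa_shift a x y alpha b c :
  kappa a (x, y - c) (alpha, b) = kappa a (x, y) (alpha, b + c).
Proof.
  assert (E : forall k, kterm a (x, y - c) (alpha, b) k = kterm a (x, y) (alpha, b + c) k).
  { intros k; unfold kterm; do 2 f_equal; unfold Cplus, Cconj; simpl; f_equal; ring. }
  unfold kappa; f_equal; apply Series_ext; intros k; now rewrite E.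
Qed.

Lemma translate_kcomb rho a alpha c l :
  translate c (kcomb rho a alpha l) = kcomb rho a alpha (shift_list c l).
Proof.
  apply functional_extensionality; intros [[x y] Hs]; unfold translate, shift_list.
  rewrite !kcomb_lsum, lsum_map; apply lsum_ext; intros p _; simpl.
  now rewrite kappa_shift.
Qed.

(** Translation moves the frequency [b] to [b + c], so the eigenvalue [i b] falls short of the new
    one by exactly [i c]. *)
Lemma translate_Tcomb rho a alpha c l :
  translate c (Tcomb rho a alpha l) =
  fsub (Tcomb rho a alpha (shift_list c l))
       (fscal (Cmult Ci (RtoC c)) (translate c (kcomb rho a alpha l))).
Proof.
  rewrite translate_kcomb, !Tcomb_kcomb, translate_kcomb, <- kcomb_scale, kcomb_sub.
  apply functional_extensionality; intros s; rewrite !kcomb_lsum, lsum_app.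
  unfold scale_list, Tlist, shift_list; rewrite !lsum_map, <- lsum_plus.
  apply lsum_ext; intros p _; cbn [fst snd]; rewrite RtoC_plus; ring.
Qed.

(** A shift multiplies the [n]-th coefficient by the unimodular number [n^{ic}], which makes
    translation isometric on the span. *)
Lemma Cmod_symbol_shift alpha c l n :
  Cmod (symbol (vertical alpha (shift_list c l)) n) = Cmod (symbol (vertical alpha l) n).
Proof.
  replace (symbol (vertical alpha (shift_list c l)) n)
    with (Cmult (npow n (0, - c)) (symbol (vertical alpha l) n)).
  - rewrite Cmod_mult, Cmod_npow_imaginary; ring.
  - rewrite !symbol_vertical, <- lsum_scal; unfold shift_list; rewrite lsum_map.
    apply lsum_ext; intros p _; cbn [fst snd].
    replace (Cconj (alpha, snd p + c)) with (Cplus (0, - c) (Cconj (alpha, snd p)))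
      by (unfold Cplus, Cconj; simpl; f_equal; ring).
    rewrite npow_add; ring.
Qed.

Section Operator.

Context {rho : R} {a : nat -> R}
        (Ha : forall n, (1 <= n)%nat -> 0 <= a n) (Hadm : admissible a)
        (Hconv : kappa_conv rho a)
        {H : Fun rho -> Prop} {ip : Fun rho -> Fun rho -> C} (HK : is_RKHS rho a H ip)
        (alpha : R) (Halpha : rho < alpha).

(** The squared norm is a sum of non-negative terms, so each of them vanishes; this replaces a
    uniqueness theorem for Dirichlet series. *)
Lemma kcomb_zero_symbol l : kcomb rho a alpha l = fzero ->
  forall n, supp a n -> symbol (vertical alpha l) n = RtoC 0.
Proof.
  intros E [|n] [Hn Hsupp]; [lia|].
  destruct (hnorm_gcomb Ha Hconv HK (vertical alpha l)) as [S1 E1];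
    [now apply in_half_plane_vertical|].
  rewrite <- kcomb_gcomb, E, (hnorm_zero HK) in E1.
  pose proof (Series_zero_terms _ S1) as Z; cbv beta in Z.
  specialize (Z ltac:(intros k; apply Rmult_le_pos; [apply Ha; lia | apply pow2_ge_0])
                ltac:(rewrite <- E1; ring) n).
  apply Rmult_integral in Z; destruct Z as [Z|Z]; [easy|].
  apply Cmod_eq_0; apply Rsqr_eq_0; now rewrite Rsqr_pow2.
Qed.

Lemma Tcomb_zero l : kcomb rho a alpha l = fzero -> Tcomb rho a alpha l = fzero.
Proof.
  intros E; destruct Hadm as [_ [Hmul (p & q & Sp & Sq & Hp & Hq & G)]].
  apply functional_extensionality; intros s.
  transitivity (lsum (fun x => Cmult (fst x) (Cmult (Cmult Ci (RtoC (snd x)))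
                  (kappa a (proj1_sig s) (alpha, snd x)))) l); [reflexivity|].
  apply (vertical_characters_independent (supp a) alpha p q) with
    (* Since [F] is arbitrary in the independence statement, it can be the value at [s] of
       [T_alpha kappa_{alpha+ib}]. *)
    (F := fun b => Cmult (Cmult Ci (RtoC b)) (kappa a (proj1_sig s) (alpha, b))); auto.
  - intros n Sn; apply Sn.
  - intros n Sn; rewrite <- symbol_vertical; now apply kcomb_zero_symbol.
Qed.

Lemma Tcomb_well_defined l l' : kcomb rho a alpha l = kcomb rho a alpha l' ->
  Tcomb rho a alpha l = Tcomb rho a alpha l'.
Proof.
  intros E.
  assert (Z : Tcomb rho a alpha (l ++ scale_list (Copp (RtoC 1)) l') = fzero).
  { apply Tcomb_zero; rewrite <- kcomb_sub, E.
    apply functional_extensionality; intros s; unfold fsub, fzero; ring. }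
  rewrite Tcomb_kcomb, Tlist_app, kcomb_app, kcomb_Tlist_scale in Z.
  apply functional_extensionality; intros s; pose proof (f_equal (fun F => F s) Z) as Zs.
  cbv beta in Zs; unfold fadd, fscal, fzero in Zs; rewrite !Tcomb_kcomb.
  replace (kcomb rho a alpha (Tlist l) s)
    with (Cplus (Cplus (kcomb rho a alpha (Tlist l) s)
                   (Cmult (Copp (RtoC 1)) (kcomb rho a alpha (Tlist l') s)))
                (kcomb rho a alpha (Tlist l') s)) by ring.
  rewrite Zs; ring.
Qed.

Lemma T_exists : exists T, T_def rho a alpha T.
Proof.
  assert (E : forall f : Fun rho, exists g : Fun rho,
            forall l, f = kcomb rho a alpha l -> g = Tcomb rho a alpha l).
  { intros f; destruct (excluded_middle_informative (Dspan rho a alpha f)) as [[l ->]|N].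
    - exists (Tcomb rho a alpha l); intros l'; apply Tcomb_well_defined.
    - exists fzero; intros l El; exfalso; apply N; now exists l. }
  exists (fun f => proj1_sig (constructive_indefinite_description _ (E f))); intros l.
  apply (proj2_sig (constructive_indefinite_description _ (E (kcomb rho a alpha l)))); reflexivity.
Qed.

Lemma H_Dspan f : Dspan rho a alpha f -> H f.
Proof. intros [l ->]; now apply (H_kcomb HK). Qed.

Lemma H_Tcomb l : H (Tcomb rho a alpha l).
Proof. rewrite Tcomb_kcomb; now apply (H_kcomb HK). Qed.

Lemma adjoint_pair_zero g h : H g -> H h ->
  (forall l, ip (Tcomb rho a alpha l) g = ip (kcomb rho a alpha l) h) -> g = fzero.
Proof.
  intros Hg Hh E; apply functional_extensionality; intros t; unfold fzero.
  rewrite <- (ip_kfun HK) by easy.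
  apply Cmod_eq_0, Rle_antisym; [|apply Cmod_ge_0].
  pose proof (H_kfun HK t) as Hk.
  rewrite (ip_conj HK _ _ Hk Hg), Cmod_conj.
  pose proof (hnorm_ge_0 (ip := ip) g) as Pg; pose proof (hnorm_ge_0 (ip := ip) h) as Ph.
  set (M := hnorm ip g + hnorm ip h + 1).
  assert (PM : 0 < M) by (unfold M; lra).
  apply le_epsilon; intros eps He; rewrite Rplus_0_l.
  destruct (graph_approximation Ha Hconv HK alpha Halpha t (eps / M)) as (l & B1 & B2);
    [now apply Rdiv_lt_0_compat|].
  set (k := kfun a (proj1_sig t)) in *.
  pose proof (H_Tcomb l) as HT; pose proof (H_kcomb HK alpha Halpha l) as Hc.
  rewrite (hnorm_sub_sym HK) in B2 by easy.
  (* Both terms are small by Cauchy-Schwarz: [T f] is close to [kappa_t], and [f] is close to 0. *)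
  replace (ip k g) with (Cplus (ip (fsub k (Tcomb rho a alpha l)) g) (ip (kcomb rho a alpha l) h))
    by (rewrite (ip_sub_l HK), <- E by easy; ring).
  eapply Rle_trans; [apply Cmod_triangle|].
  pose proof (H_sub HK k _ Hk HT) as Hd.
  eapply Rle_trans; [apply Rplus_le_compat; apply (Cauchy_Schwarz HK); easy|].
  apply Rle_trans with (eps / M * hnorm ip g + eps / M * hnorm ip h).
  - apply Rplus_le_compat; apply Rmult_le_compat_r; lra.
  - replace eps with (eps / M * M) at 3 by (field; lra).
    assert (0 < eps / M) by now apply Rdiv_lt_0_compat.
    rewrite <- Rmult_plus_distr_l; apply Rmult_le_compat_l; [lra | unfold M; lra].
Qed.

Lemma D_dense : densely_defined H ip (Dspan rho a alpha).
Proof.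
  apply (dense_of_trivial_orthogonal HK).
  - exact H_Dspan.
  - exists nil; reflexivity.
  - intros u w [l ->] [l' ->]; exists (l ++ l'); symmetry; apply kcomb_app.
  - intros c u [l ->]; exists (scale_list c l); symmetry; apply kcomb_scale.
  (* The values of [T_alpha] lie in the span again, so both sides of the adjoint relation vanish. *)
  - intros h Hh O; apply (adjoint_pair_zero h fzero); [easy | apply (H_zero HK)|].
    assert (O' : forall l, ip (kcomb rho a alpha l) h = RtoC 0).
    { intros l; pose proof (H_kcomb HK alpha Halpha l) as Hl.
      rewrite (ip_conj HK h) by easy; rewrite O by now exists l.
      unfold Cconj, RtoC; simpl; f_equal; ring. }
    intros l; rewrite Tcomb_kcomb, O'.
    replace (@fzero rho) with (fscal (RtoC 0) h)
      by (apply functional_extensionality; intros s; apply Cmult_0_l).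
    rewrite (ip_scal_r HK), O' by (easy || now apply (H_kcomb HK)).
    now rewrite Cmult_0_r.
Qed.

Lemma hnorm_kcomb_shift c l :
  hnorm ip (kcomb rho a alpha (shift_list c l)) = hnorm ip (kcomb rho a alpha l).
Proof.
  rewrite !kcomb_gcomb.
  assert (E : hnorm ip (gcomb (rho := rho) a (vertical alpha (shift_list c l))) ^ 2 =
              hnorm ip (gcomb (rho := rho) a (vertical alpha l)) ^ 2).
  { destruct (hnorm_gcomb Ha Hconv HK (vertical alpha l)) as [_ ->];
      [now apply in_half_plane_vertical|].
    destruct (hnorm_gcomb Ha Hconv HK (vertical alpha (shift_list c l))) as [_ ->];
      [now apply in_half_plane_vertical|].
    apply Series_ext; intros k; now rewrite Cmod_symbol_shift. }
  rewrite <- !Rsqr_pow2 in E; apply Rsqr_inj in E; auto using hnorm_ge_0.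
Qed.

(** It is not known beforehand that [H] is invariant under translation. Combinations [fs n -> f]
    have translates that form a Cauchy sequence; evaluating at points shows that their limit in [H]
    is [translate c f]. *)
Lemma translate_isometry c f : H f -> H (translate c f) /\ hnorm ip (translate c f) = hnorm ip f.
Proof.
  intros Hf; destruct D_dense as [_ Hdense].
  assert (Happ : forall n, exists l, hnorm ip (fsub f (kcomb rho a alpha l)) < / (INR n + 1)).
  { intros n; destruct (Hdense f Hf _ (inv_S_pos n)) as [u [[l ->] B]]; now exists l. }
  pose (ls n := proj1_sig (constructive_indefinite_description _ (Happ n))).
  assert (Hls : forall n, hnorm ip (fsub f (kcomb rho a alpha (ls n))) < / (INR n + 1))
    by (intros n; exact (proj2_sig (constructive_indefinite_description _ (Happ n)))).
  clearbody ls; clear Happ.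
  set (fs n := kcomb rho a alpha (ls n)) in *.
  assert (Hfs : forall n, H (fs n)) by (intros n; exact (H_kcomb HK alpha Halpha (ls n))).
  assert (Hus : forall n, H (translate c (fs n)))
    by (intros n; unfold fs; rewrite translate_kcomb; exact (H_kcomb HK alpha Halpha _)).
  assert (Iso : forall n, hnorm ip (translate c (fs n)) = hnorm ip (fs n))
    by (intros n; unfold fs; rewrite translate_kcomb; apply hnorm_kcomb_shift).
  assert (IsoS : forall m n, hnorm ip (fsub (translate c (fs m)) (translate c (fs n))) =
                             hnorm ip (fsub (fs m) (fs n))).
  { intros m n; change (fsub (translate c (fs m)) (translate c (fs n)))
      with (translate c (fsub (fs m) (fs n))).
    unfold fs; rewrite kcomb_sub, translate_kcomb; apply hnorm_kcomb_shift. }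
  assert (Lf : hlim ip fs f).
  { intros eps He; destruct (inv_S_small eps He) as [N HN]; exists N; intros n Hn.
    rewrite (hnorm_sub_sym HK) by easy; eapply Rlt_trans; [apply Hls | now apply HN]. }
  destruct (H_complete HK (fun n => translate c (fs n)) Hus) as [g [Hg Lg]].
  { intros eps He; destruct (Lf (eps / 2)) as [N HN]; [lra|].
    exists N; intros m n Hm Hn; rewrite IsoS.
    eapply Rle_lt_trans; [apply (hnorm_sub_triangle HK _ f); easy|].
    rewrite (hnorm_sub_sym HK f) by easy.
    pose proof (HN m Hm); pose proof (HN n Hn); lra. }
  assert (E : translate c f = g).
  { apply functional_extensionality; intros s.
    assert (Z : Cminus (translate c f s) (g s) = RtoC 0).
    { apply Cmod_eq_0, Rle_antisym; [|apply Cmod_ge_0].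
      apply le_epsilon; intros eps He; rewrite Rplus_0_l.
      destruct (hlim_eval HK fs f Hfs Hf Lf (shift_point c s) (eps / 2)) as [N1 H1]; [lra|].
      destruct (hlim_eval HK _ g Hus Hg Lg s (eps / 2)) as [N2 H2]; [lra|].
      specialize (H1 (N1 + N2)%nat ltac:(lia)); specialize (H2 (N1 + N2)%nat ltac:(lia)).
      unfold translate in *; set (x := fs (N1 + N2)%nat (shift_point c s)) in *.
      replace (Cminus (f (shift_point c s)) (g s))
        with (Cplus (Cminus x (g s)) (Copp (Cminus x (f (shift_point c s))))) by ring.
      eapply Rle_trans; [apply Cmod_triangle|]; rewrite Cmod_opp; lra. }
    replace (translate c f s) with (Cplus (Cminus (translate c f s) (g s)) (g s)) by ring.
    rewrite Z; ring. }
  rewrite E; split; [easy|].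
  assert (Close : forall u v, H u -> H v -> hnorm ip u <= hnorm ip (fsub u v) + hnorm ip v).
  { intros u v Hu Hv; replace u with (fadd (fsub u v) v) at 1
      by (apply functional_extensionality; intros s; unfold fadd, fsub; ring).
    apply (hnorm_add_le HK); [now apply (H_sub HK) | easy]. }
  apply Rle_antisym; apply le_epsilon; intros eps He;
    (destruct (Lf (eps / 2)) as [N1 H1]; [lra|]; destruct (Lg (eps / 2)) as [N2 H2]; [lra|]);
    specialize (H1 (N1 + N2)%nat ltac:(lia)); specialize (H2 (N1 + N2)%nat ltac:(lia));
    cbv beta in H2; set (n := (N1 + N2)%nat) in *.
  - rewrite (hnorm_sub_sym HK) in H2 by easy.
    pose proof (Close g (translate c (fs n)) Hg (Hus n)).
    pose proof (Close (fs n) f (Hfs n) Hf); rewrite Iso in *; lra.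
  - rewrite (hnorm_sub_sym HK) in H1 by easy.
    pose proof (Close f (fs n) Hf (Hfs n)).
    pose proof (Close (translate c (fs n)) g (Hus n) Hg); rewrite Iso in *; lra.
Qed.

Lemma translate_unitary c : unitary H ip (translate c).
Proof.
  assert (HR : forall f g, H f -> H g ->
            Re (ip (translate c f) (translate c g)) = Re (ip f g)).
  { intros f g Hf Hg.
    destruct (translate_isometry c f Hf) as [Hf' Ef].
    destruct (translate_isometry c g Hg) as [Hg' Eg].
    destruct (translate_isometry c (fsub f g) (H_sub HK f g Hf Hg)) as [_ Es].
    change (translate c (fsub f g)) with (fsub (translate c f) (translate c g)) in Es.
    pose proof (hnorm_sub_sqr HK f g Hf Hg) as P1.
    pose proof (hnorm_sub_sqr HK _ _ Hf' Hg') as P2.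
    rewrite Es, Ef, Eg in P2; lra. }
  (* Additivity and homogeneity of a translation hold by conversion, so three clauses remain. *)
  repeat split.
  - intros f Hf; now apply translate_isometry.
  - intros f g Hf Hg.
    pose proof (HR f g Hf Hg) as E1.
    (* The real part of [-i z] is the imaginary part of [z], so [HR] yields both components. *)
    pose proof (HR (fscal (Copp Ci) f) g (H_scal HK _ _ Hf) Hg) as E2.
    change (translate c (fscal (Copp Ci) f)) with (fscal (Copp Ci) (translate c f)) in E2.
    rewrite !(ip_scal_l HK) in E2 by (easy || now apply translate_isometry).
    destruct (ip (translate c f) (translate c g)) as [x y], (ip f g) as [x' y'].
    simpl in E1, E2; f_equal; lra.
  - intros g Hg; exists (translate (- c) g); split.
    + now apply translate_isometry.
    + apply translate_translate.
Qed.

(** A closed linear extension would send 0 to [kappa_alpha], hence [kappa_alpha = 0], although its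
    Dirichlet coefficients are non-zero on the support of [a]. *)
Lemma not_closable (T : Fun rho -> Fun rho) : T_def rho a alpha T ->
  ~ closable H ip (Dspan rho a alpha) T.
Proof.
  intros HT (DS & S & HS & _ & Sscal & Sext & Sclosed).
  (* At this point [kappa_t] is itself in the span, with [b = 0], so [kcomb_zero_symbol] applies to
     it. *)
  set (t := exist _ (RtoC alpha) Halpha : Hrho rho).
  assert (Happ : forall n, exists l, hnorm ip (kcomb rho a alpha l) < / (INR n + 1) /\
      hnorm ip (fsub (Tcomb rho a alpha l) (kfun a (proj1_sig t))) < / (INR n + 1)).
  { intros n; apply (graph_approximation Ha Hconv HK); [easy | apply inv_S_pos]. }
  pose (ls n := proj1_sig (constructive_indefinite_description _ (Happ n))).
  assert (Hls : forall n, hnorm ip (kcomb rho a alpha (ls n)) < / (INR n + 1) /\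
      hnorm ip (fsub (Tcomb rho a alpha (ls n)) (kfun a (proj1_sig t))) < / (INR n + 1))
    by (intros n; exact (proj2_sig (constructive_indefinite_description _ (Happ n)))).
  clearbody ls; clear Happ.
  destruct (Sclosed (fun n => kcomb rho a alpha (ls n)) fzero (kfun a (proj1_sig t)))
    as [D0 S0].
  - intros n; apply Sext; now exists (ls n).
  - apply (H_zero HK).
  - apply (H_kfun HK).
  - intros eps He; destruct (inv_S_small eps He) as [N HN]; exists N; intros n Hn.
    replace (fsub (kcomb rho a alpha (ls n)) fzero) with (kcomb rho a alpha (ls n))
      by (apply functional_extensionality; intros s; unfold fsub, fzero; ring).
    eapply Rlt_trans; [apply Hls | now apply HN].
  - intros eps He; destruct (inv_S_small eps He) as [N HN]; exists N; intros n Hn.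
    assert (E : S (kcomb rho a alpha (ls n)) = Tcomb rho a alpha (ls n))
      by (rewrite <- HT; apply Sext; now exists (ls n)).
    cbv beta; rewrite E; eapply Rlt_trans; [apply Hls | now apply HN].
  - destruct (Sscal (RtoC 0) _ D0) as [_ Z].
    replace (fscal (RtoC 0) (@fzero rho)) with (@fzero rho) in Z
      by (symmetry; apply functional_extensionality; intros s; apply Cmult_0_l).
    rewrite S0 in Z.
    assert (K0 : kcomb rho a alpha ((RtoC 1, 0) :: nil) = fzero).
    { apply functional_extensionality; intros s.
      pose proof (f_equal (fun F => F s) Z) as Zs; unfold fscal, kfun in Zs; simpl in Zs.
      rewrite Cmult_0_l in Zs.
      rewrite kcomb_lsum, lsum_cons, lsum_nil; cbn [fst snd].
      change (alpha, 0) with (RtoC alpha); rewrite Zs; unfold fzero; ring. }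
    destruct Hadm as [_ [_ (p & _ & Sp & _)]].
    pose proof (kcomb_zero_symbol _ K0 p Sp) as E.
    rewrite symbol_vertical, lsum_cons, lsum_nil in E; cbn [fst snd] in E.
    apply (npow_neq0 p (Cconj (alpha, 0))); rewrite <- E; ring.
Qed.

End Operator.

Theorem theorem5p4 (rho : R) (a : nat -> R) (H : Fun rho -> Prop)
    (ip : Fun rho -> Fun rho -> C) :
  (forall n, (1 <= n)%nat -> 0 <= a n) ->
  admissible a ->
  kappa_conv rho a ->
  is_RKHS rho a H ip ->
  forall alpha : R, rho < alpha ->
    (exists T, T_def rho a alpha T) /\
    forall T : Fun rho -> Fun rho, T_def rho a alpha T ->
      T_homogeneous H ip (Dspan rho a alpha) T /\
      (forall g, adj_dom H ip (Dspan rho a alpha) T g <-> g = fzero) /\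
      ~ closable H ip (Dspan rho a alpha) T.
Proof.
  intros Ha Hadm Hconv HK alpha Halpha.
  split; [now apply (T_exists Ha Hadm Hconv HK)|].
  intros T HT; split; [split|split].
  - now apply (D_dense Ha Hconv HK).
  - intros c; exists (translate c); split; [now apply (translate_unitary Ha Hconv HK alpha)|split].
    + intros f [l ->]; rewrite translate_kcomb; now exists (shift_list c l).
    + intros f [l ->]; rewrite HT, translate_Tcomb; do 2 f_equal.
      now rewrite translate_kcomb, HT.
  - intros g; split.
    + intros [Hg [h [Hh E]]]; apply (adjoint_pair_zero Ha Hconv HK alpha Halpha g h Hg Hh).
      intros l; rewrite <- HT; apply E; now exists l.
    + intros ->; split; [apply (H_zero HK)|]; exists fzero; split; [apply (H_zero HK)|].
      assert (Z : forall f, H f -> ip f fzero = RtoC 0).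
      { intros f Hf; apply Cmod_eq_0, Rle_antisym; [|apply Cmod_ge_0].
        eapply Rle_trans; [apply (Cauchy_Schwarz HK); [easy | apply (H_zero HK)]|].
        rewrite (hnorm_zero HK); lra. }
      intros f [l ->]; rewrite HT, !Z; [easy | now apply (H_kcomb HK) | now apply (H_Tcomb HK)].
  - now apply (not_closable Ha Hadm Hconv HK).
Qed.
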